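(* Let $\Omega\subset\mathbb{R}^3$ be a domain and let $\Phi:\Omega_\zeta\to\mathbb{A}_n^m$ be continuous in $\Omega_\zeta$. If $\int_{\partial\Delta_\zeta}\Phi(\zeta)\,d\zeta=0$ for every triangle $\Delta_\zeta$ whose closure $\overline{\Delta_\zeta}$ is contained in $\Omega_\zeta$, then $\Phi$ is monogenic in $\Omega_\zeta$.
   Context: Fix natural numbers $m\le n$. $\mathbb{A}_n^m$ is a commutative associative algebra with unit over $\mathbb{C}$ with a basis $\{I_k\}_{k=1}^n$ satisfying: (1) for $r,s\in\{1,\dots,m\}$, $I_rI_s=0$ if $r\ne s$ and $I_rI_r=I_r$; (2) for $r,s\in\{m+1,\dots,n\}$, $I_rI_s=\sum_{k=\max\{r,s\}+1}^{n}\Upsilon^{s}_{r,k}I_k$ with constants $\Upsilon^s_{r,k}\in\mathbb{C}$; (3) for each $s\in\{m+1,\dots,n\}$ there is a unique $u_s\in\{1,\dots,m\}$ such that for $r\in\{1,\dots,m\}$, $I_rI_s=I_s$ if $r=u_s$ and $0$ otherwise. Unit $1=\sum_{u=1}^mI_u$. $f_u(\sum_k\lambda_kI_k)=\lambda_u$, $u=1,\dots,m$. Let $e_1=1$, $e_2=\sum_ka_kI_k$, $e_3=\sum_kb_kI_k$ be linearly independent over $\mathbb{R}$; $\zeta=xe_1+ye_2+ze_3$, $E_3$ the real span of $e_1,e_2,e_3$, $Q_\zeta=\{xe_1+ye_2+ze_3:(x,y,z)\in Q\}$ for $Q\subset\mathbb{R}^3$ (a triangle $\Delta_\zeta$ means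 $\Delta_\zeta$ for a planar triangle $\Delta\subset\mathbb{R}^3$, and $\partial\Delta_\zeta$ its boundary curve). Standing assumption: $f_u(E_3)=\mathbb{C}$ for all $u$. A continuous $\Phi:\Omega_\zeta\to\mathbb{A}_n^m$ is monogenic if for every $\zeta\in\Omega_\zeta$ there is $\Phi'(\zeta)\in\mathbb{A}_n^m$ with $\lim_{\varepsilon\to0+}(\Phi(\zeta+\varepsilon h)-\Phi(\zeta))\varepsilon^{-1}=h\Phi'(\zeta)$ for all $h\in E_3$. Integral: for a Jordan rectifiable curve $\gamma$ and continuous $\Psi=\sum_k(U_k+iV_k)I_k$ on $\gamma_\zeta$ ($U_k,V_k$ real), $\int_{\gamma_\zeta}\Psi d\zeta:=\sum_kI_k\int_\gamma(U_k+iV_k)dx+\sum_ke_2I_k\int_\gamma(U_k+iV_k)dy+\sum_ke_3I_k\int_\gamma(U_k+iV_k)dz$. *)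

(* Defs.v *)
From HB Require Import structures.
From mathcomp Require Import all_boot all_order all_algebra.
From mathcomp Require Import all_classical all_reals all_analysis.
From mathcomp Require Import complex.
Unset Strict Implicit. Unset Printing Implicit Defensive.
Import Order.TTheory GRing.Theory Num.Theory.
Import numFieldNormedType.Exports.
Local Open Scope classical_set_scope.
Local Open Scope ring_scope.
Local Open Scope complex_scope.

Section Anm.
Variable R : realType.

Definition pt := (R * R * R)%type.
Definition px (p : pt) : R := p.1.1.
Definition py (p : pt) : R := p.1.2.
Definition pz (p : pt) : R := p.2.

(* Elements of A_n^m: coordinate functions w.r.t. the alg_basis I_0,...,I_{n-1}
   (0-based: I_0..I_{m-1} are the idempotents, I_m..I_{n-1} the nilpotents). *)
Definition cre (w : R[i]) : R := complex.Re w.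
Definition cim (w : R[i]) : R := complex.Im w.

Definition alg (n : nat) := 'I_n -> R[i].

Definition alg_add n (a b : alg n) : alg n := fun k => a k + b k.
Arguments alg_add {n}.
Definition alg_sub n (a b : alg n) : alg n := fun k => a k - b k.
Arguments alg_sub {n}.
Definition alg_rscale n (r : R) (a : alg n) : alg n := fun k => r%:C * a k.
Arguments alg_rscale {n}.
Definition alg_zero n : alg n := fun _ => 0.
Definition alg_basis n (j : 'I_n) : alg n := fun k => (k == j)%:R.
Definition alg_one (m n : nat) : alg n := fun k => (nat_of_ord k < m)%:R.
Definition alg_mul n (Ups : 'I_n -> 'I_n -> 'I_n -> R[i]) (a b : alg n) : alg n :=
  fun k => \sum_(r < n) \sum_(s < n) a r * b s * Ups r s k.
Arguments alg_mul {n}.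

Definition is_Anm (m n : nat) (Ups : 'I_n -> 'I_n -> 'I_n -> R[i]) : Prop :=
  (0 < m)%N /\ (m <= n)%N /\
      (forall r s k, Ups r s k = Ups s r k) /\
      (forall r s t l, \sum_(k < n) Ups r s k * Ups k t l
                     = \sum_(k < n) Ups s t k * Ups r k l) /\
      (forall r s k : 'I_n, (r < m)%N -> (s < m)%N ->
          Ups r s k = if r == s then (k == r)%:R else 0) /\
      (* (2) I_r I_s = sum_{k = max(r,s)+1}^{n} Ups r s k I_k *)
      (forall r s k : 'I_n, (m <= r)%N -> (m <= s)%N -> (k <= maxn r s)%N ->
          Ups r s k = 0) /\
      (forall s : 'I_n, (m <= s)%N ->
         exists2 u : 'I_n, (u < m)%N &
           forall r k : 'I_n, (r < m)%N ->
             Ups r s k = if r == u then (k == s)%:R else 0).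

(* e_1 = 1, e_2 = sum a_k I_k, e_3 = sum b_k I_k linearly independent over R *)
Definition lin_indep_R (m n : nat) (a b : alg n) : Prop :=
  forall al be ga : R,
    alg_add (alg_add (alg_rscale al (alg_one m n)) (alg_rscale be a))
            (alg_rscale ga b) = alg_zero n ->
    [/\ al = 0, be = 0 & ga = 0].

(* Standing assumption f_u(E_3) = C for all u < m. *)
Definition fu_surj (m n : nat) (a b : alg n) : Prop :=
  forall u : 'I_n, (u < m)%N -> forall w : R[i],
    exists x y z : R, x%:C * alg_one m n u + y%:C * a u + z%:C * b u = w.

Definition zeta (m n : nat) (a b : alg n) (p : pt) : alg n :=
  alg_add (alg_add (alg_rscale (px p) (alg_one m n)) (alg_rscale (py p) a))
          (alg_rscale (pz p) b).

Definition is_domain (Omega : set pt) : Prop := open Omega /\ connected Omega.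

(* continuity of an A_n^m-valued function of (x,y,z) at each point of Omega
   (the topology of A_n^m ~ C^n ~ R^{2n} is the product one) *)
Definition alg_continuous_on n (Omega : set pt) (F : pt -> alg n) : Prop :=
  forall p, Omega p -> forall k : 'I_n,
    {for p, continuous (fun q => cre (F q k))} /\
    {for p, continuous (fun q => cim (F q k))}.
Arguments alg_continuous_on {n}.

Definition monogenic (m n : nat) (Ups : 'I_n -> 'I_n -> 'I_n -> R[i])
  (a b : alg n) (Omega : set pt) (Phi : alg n -> alg n) : Prop :=
  forall p, Omega p ->
    exists Phi' : alg n, forall h : pt, forall k : 'I_n,
      let Q := fun eps : R =>
        alg_rscale eps^-1 (alg_sub (Phi (alg_add (zeta m n a b p)
                                           (alg_rscale eps (zeta m n a b h))))
                                   (Phi (zeta m n a b p))) in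
      let L := alg_mul Ups (zeta m n a b h) Phi' in
      (fun eps => cre (Q eps k)) @ at_right 0 --> cre (L k) /\
      (fun eps => cim (Q eps k)) @ at_right 0 --> cim (L k).

Definition seg (p q : pt) (t : R) : pt :=
  (px p + t * (px q - px p), py p + t * (py q - py p), pz p + t * (pz q - pz p)).

Definition cint01 (g : R -> R[i]) : R[i] :=
  Complex (\int[lebesgue_measure]_(t in `[0, 1]%classic) cre (g t))
          (\int[lebesgue_measure]_(t in `[0, 1]%classic) cim (g t)).

Definition seg_int (coord : pt -> R) (g : pt -> R[i]) (p q : pt) : R[i] :=
  cint01 (fun t => g (seg p q t)) * (coord q - coord p)%:C.

Definition tri_int (coord : pt -> R) (g : pt -> R[i]) (A B C : pt) : R[i] :=
  seg_int coord g A B + seg_int coord g B C + seg_int coord g C A.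

(* int_{partial Delta_zeta} Phi(zeta) d zeta
   = sum_k I_k int Phi_k dx + sum_k e_2 I_k int Phi_k dy + sum_k e_3 I_k int Phi_k dz *)
Definition tri_integral (m n : nat) (Ups : 'I_n -> 'I_n -> 'I_n -> R[i])
  (a b : alg n) (Phi : alg n -> alg n) (A B C : pt) : alg n :=
  let g k := fun p => Phi (zeta m n a b p) k in
  let Jx : alg n := fun k => tri_int px (g k) A B C in
  let Jy : alg n := fun k => tri_int py (g k) A B C in
  let Jz : alg n := fun k => tri_int pz (g k) A B C in
  alg_add (alg_add Jx (alg_mul Ups a Jy)) (alg_mul Ups b Jz).

Definition nondeg_triangle (A B C : pt) : Prop :=
  forall s t : R,
    s * (px B - px A) + t * (px C - px A) = 0 ->
    s * (py B - py A) + t * (py C - py A) = 0 ->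
    s * (pz B - pz A) + t * (pz C - pz A) = 0 -> s = 0 /\ t = 0.

Definition closed_triangle (A B C : pt) : set pt :=
  [set p | exists s t : R, [/\ 0 <= s, 0 <= t, s + t <= 1 &
     p = (px A + s * (px B - px A) + t * (px C - px A),
          py A + s * (py B - py A) + t * (py C - py A),
          pz A + s * (pz B - pz A) + t * (pz C - pz A))]].

End Anm.
Arguments px {R}.
Arguments py {R}.
Arguments pz {R}.
Arguments cre {R}.
Arguments cim {R}.
Arguments alg_add {R n}.
Arguments alg_sub {R n}.
Arguments alg_rscale {R n}.
Arguments alg_zero {R}.
Arguments alg_basis {R}.
Arguments alg_one {R}.
Arguments alg_mul {R n}.
Arguments is_Anm {R}.
Arguments lin_indep_R {R}.
Arguments fu_surj {R}.
Arguments zeta {R}.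
Arguments is_domain {R}.
Arguments alg_continuous_on {R n}.
Arguments monogenic {R}.
Arguments seg {R}.
Arguments cint01 {R}.
Arguments seg_int {R}.
Arguments tri_int {R}.
Arguments tri_integral {R}.
Arguments nondeg_triangle {R}.
Arguments closed_triangle {R}.

(* Main.v *)
Require Import Defs.
From HB Require Import structures.
From mathcomp Require Import all_boot all_order all_algebra.
From mathcomp Require Import all_classical all_reals all_analysis.
From mathcomp Require Import complex.
From mathcomp Require Import ring lra.
Set Implicit Arguments.
Unset Strict Implicit.
Unset Printing Implicit Defensive.
Import Order.TTheory GRing.Theory Num.Theory.
Import numFieldNormedType.Exports.
Local Open Scope classical_set_scope.
Local Open Scope ring_scope.

(* Locally Phi has a primitive F with dF = Phi dzeta (integrate along segments from a base
   point). Since every f_u maps E_3 onto C, there is a real t such that each f_u is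
   injective on the plane spanned by e_1 and e_2 + t e_3, so the ellipse gamma(x) = cos x
   e_1 + sin x (e_2 + t e_3) consists of invertible elements; put kappa = gamma' gamma^-2 =
   -(gamma^-1)'. For H(s) = int F(q + s gamma) kappa dx over [0, 2 pi], differentiating
   under the integral gives H'(s) = int Phi(q + s gamma) gamma' gamma^-1 dx, and integrating
   by parts in x gives s H'(s) = H(s). Hence H is linear, i.e. rho^-1 H(rho) = H'(0) =
   Phi(q) c with c = int gamma' gamma^-1 dx, and c is invertible because each f_u(c) has a
   nonzero imaginary part. Thus Phi(q) = (c rho)^-1 int F(q + rho gamma) kappa dx, where q
   enters only through the C^1 function F, so Phi can be differentiated under the integral
   sign. The argument is carried out over R, writing the algebra as functions K -> R on a
   finite basis K with real structure constants. *)

(** * Calculus of real functions *)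

Section ScalarCalculus.
Variable R : realType.
Implicit Types (f g : R -> R) (a b t : R).

Lemma is_derive_ext f g t d :
  f =1 g -> is_derive t 1 f d -> is_derive t 1 g d.
Proof. by move=> /funext ->. Qed.

Lemma is_derive_fsum (I : Type) (s : seq I) (f : I -> R -> R) (d : I -> R) t :
  (forall i, is_derive t 1 (f i) (d i)) ->
  is_derive t 1 (fun x => \sum_(i <- s) f i x) (\sum_(i <- s) d i).
Proof.
move=> fd; elim: s => [|i s IH].
  apply: (@is_derive_ext (cst 0)); first by move=> x; rewrite big_nil.
  by rewrite big_nil; exact: is_derive_cst.
apply: (@is_derive_ext (f i + fun x => \sum_(i <- s) f i x)).
  by move=> x; rewrite big_cons.
by rewrite big_cons; exact: is_deriveD.
Qed.

Lemma is_derive_fmul f g t df dg :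
  is_derive t 1 f df -> is_derive t 1 g dg ->
  is_derive t 1 (fun x => f x * g x) (df * g t + f t * dg).
Proof.
move=> fd gd; apply: (@is_derive_eq _ _ _ _ _ _ _ _ (is_deriveM fd gd)).
by rewrite /GRing.scale/= addrC [g t * df]mulrC.
Qed.

Lemma is_derive_continuous f t d : is_derive t 1 f d -> {for t, continuous f}.
Proof.
move=> fd; apply: differentiable_continuous; apply/derivable1_diffP.
exact: ex_derive.
Qed.

Lemma is_derive_slope f t d :
  is_derive t 1 f d <-> (fun h => h^-1 * (f (h + t) - f t)) @ 0^' --> d.
Proof.
have E : (fun h => h^-1 * (f (h + t) - f t)) =
         (fun h => h^-1 *: ((f \o shift t) (h *: 1) - f t)).
  by apply/funext => h; rewrite /= /GRing.scale/= mulr1.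
split=> [fd|fd].
  have [] := fd; rewrite /derivable /derive /= => fc fe.
  by rewrite -fe E; exact: fc.
split; first by rewrite /derivable; apply/cvg_ex; exists d; rewrite -E.
by rewrite /derive -E; exact/cvg_lim.
Qed.

Lemma is_derive_right f t d : is_derive t 1 f d ->
  (fun h => h^-1 * (f (t + h) - f t)) @ at_right 0 --> d.
Proof.
move=> /is_derive_slope fd.
under eq_fun do rewrite addrC [t + _]addrC addrC.
exact: cvg_dnbhs_at_right fd.
Qed.

Lemma continuous_integrable f a b : continuous f ->
  (@lebesgue_measure R).-integrable `[a, b] (EFin \o f).
Proof.
move=> cf; apply: continuous_compact_integrable; first exact: segment_compact.
exact: continuous_subspaceT.
Qed.

Lemma Rintegral_sum (I : Type) (s : seq I) (f : I -> R -> R) a b :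
  (forall i, continuous (f i)) ->
  \int[lebesgue_measure]_(t in `[a, b]) (\sum_(i <- s) f i t) =
  \sum_(i <- s) \int[lebesgue_measure]_(t in `[a, b]) f i t.
Proof.
move=> cf; elim: s => [|i s IH].
  rewrite big_nil; under eq_Rintegral do rewrite big_nil.
  by rewrite Rintegral_cst// mul0r.
rewrite big_cons -IH -RintegralD //; first by under eq_Rintegral do rewrite big_cons.
- exact: continuous_integrable.
- by apply: continuous_integrable; apply: continuous_big => //; exact: add_continuous.
Qed.

Lemma FTC2 f F a b : a < b -> continuous f ->
  (forall t, is_derive t 1 F (f t)) ->
  \int[lebesgue_measure]_(t in `[a, b]) f t = F b - F a.
Proof.
move=> ab cf Fd.
have cF t : {for t, continuous F} by exact: is_derive_continuous (Fd t).
rewrite /Rintegral (@continuous_FTC2 R f F a b) //.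
- exact: continuous_subspaceT.
- split; first by move=> x _; exact: ex_derive.
  + by apply: cvg_at_right_filter; exact: cF.
  + by apply: cvg_at_left_filter; exact: cF.
- by move=> x _; rewrite derive1E; exact: derive_val.
Qed.

Lemma Rintegral_cst_itv (C : R) a b : a <= b ->
  \int[lebesgue_measure]_(t in `[a, b]) C = C * (b - a).
Proof.
rewrite Rintegral_cst// le_eqVlt => /predU1P[->|ab]; congr (_ * _).
  by rewrite subrr set_itv1; have := lebesgue_measure_set1 b => /= ->.
by have := @lebesgue_measure_itv R `[a, b]; rewrite /= lte_fin ab => ->.
Qed.

Lemma Rintegral_gt0 f a b (c : R) : a < b -> 0 < c -> continuous f ->
  (forall t, c <= f t) -> 0 < \int[lebesgue_measure]_(t in `[a, b]) f t.
Proof.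
move=> ab c0 cf cle; apply: (@lt_le_trans _ _ (c * (b - a))).
  by rewrite mulr_gt0// subr_gt0.
rewrite -(Rintegral_cst_itv c (ltW ab)); apply: le_Rintegral => //.
- by apply: continuous_integrable => x; exact: cvg_cst.
- exact: continuous_integrable.
Qed.

Lemma Rintegral_bound f a b C : a <= b -> continuous f ->
  (forall t, a <= t <= b -> `|f t| <= C) ->
  `|\int[lebesgue_measure]_(t in `[a, b]) f t| <= C * (b - a).
Proof.
move=> ab cf fC.
apply: le_trans (le_normr_Rintegral _ _) _ => //; first exact: continuous_integrable.
rewrite -Rintegral_cst_itv//.
apply: le_Rintegral => //.
- by apply: continuous_integrable => x; apply: cvg_norm; exact: cf.
- by apply: continuous_integrable => x; exact: cvg_cst.
Qed.

(** This is dominated convergence: a constant bounding the partial derivative is an integrable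
    majorant on the bounded interval. *)
Lemma is_derive_Rintegral (f df : R -> R -> R) a b u v C :
  (forall t, u < t < v -> continuous (f t)) ->
  (forall t x, u < t < v -> is_derive t 1 (f ^~ x) (df t x)) ->
  (forall t x, u < t < v -> a <= x <= b -> `|df t x| <= C) ->
  forall t, u < t < v ->
  is_derive t 1 (fun t => \int[lebesgue_measure]_(x in `[a, b]) f t x)
    (\int[lebesgue_measure]_(x in `[a, b]) df t x).
Proof.
move=> cf fd dC t tuv.
have It : `]u, v[%classic t by rewrite /= in_itv.
have E s x : u < s < v -> partial1of2 f s x = df s x.
  by move=> /fd fsx; rewrite partial1of2E; exact: derive_val.
have -> : \int[lebesgue_measure]_(x in `[a, b]) df t x =
    \int[lebesgue_measure]_(x in `[a, b]) partial1of2 f t x.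
  by apply: eq_Rintegral => x _; rewrite E.
apply/is_derive_slope.
(* The majorant has to be nonnegative, hence [|C|] in place of [C]. *)
have := @cvg_differentiation_under_integral R _ _ lebesgue_measure f
  `[a, b]%classic (measurable_itv _) t u v It _ _ (cst `|C|) _ _ _.
apply.
- by move=> s /=; rewrite in_itv/= => /cf; exact: continuous_integrable.
- by move=> s x /=; rewrite in_itv/= => uv _; have ? := fd s x uv; exact: ex_derive.
- by move=> ?; exact: normr_ge0.
- by apply: continuous_integrable => x; exact: cvg_cst.
- move=> s x /=; rewrite !in_itv/= => uv xab; rewrite E//.
  exact: le_trans (dC _ _ uv xab) (ler_norm _).
Qed.

(** Since [f' = m] and [f t = t * m t], the quotient [f t / t] has zero derivative for [t > 0], so
    it is constant there. As [f 0 = 0], its limit at [0+] is the derivative of [f] at 0, which is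
    [m 0]. *)
Lemma radial_linear (f m : R -> R) b rho : 0 < rho < b ->
  (forall t, - b < t < b -> is_derive t 1 f (m t)) ->
  (forall t, - b < t < b -> f t = t * m t) -> f rho = rho * m 0.
Proof.
move=> /andP[rho0 rhob] fd fm.
have ratio t : 0 < t -> t < rho -> f t / t = f rho / rho.
  move=> t0 trho.
  have d0 x : x \in `[t, rho] -> is_derive x 1 (fun y => f y * y^-1) 0.
    rewrite in_itv/= => /andP[tx xrho].
    have x0 : x != 0 by rewrite gt_eqF//; lra.
    have xb : - b < x < b by lra.
    have := is_derive_fmul (fd x xb) (is_deriveV (f := id) x0 (is_derive_id x 1)).
    move=> H; apply: (@is_derive_eq _ _ _ _ _ _ _ _ H); rewrite (fm x xb) /GRing.scale/=; field.
    exact: x0.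
  have cq : {within `[t, rho], continuous (fun y => f y * y^-1)}.
    by apply: derivable_within_continuous => x /d0 ?; exact: ex_derive.
  have dq x : x \in `]t, rho[ -> is_derive x 1 (fun y => f y * y^-1) (cst 0 x).
    by move=> xt; apply: d0; exact: subset_itv_oo_cc xt.
  have [x _ /eqP] := MVT trho dq cq.
  by rewrite /cst mul0r subr_eq0 => /eqP.
have b0 : - b < 0 < b by lra.
have f0 : f 0 = 0 by rewrite fm// mul0r.
have := is_derive_right (fd 0 b0).
have : (fun h => h^-1 * (f (0 + h) - f 0)) @ at_right 0 --> f rho / rho.
  apply: (@cvg_trans _ ((fun=> f rho / rho) @ at_right 0)); last exact: cvg_cst.
  apply: near_eq_cvg.
  near=> h; rewrite /= f0 add0r subr0 [h^-1 * _]mulrC ratio//.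
move=> l1 l2; have <- := cvg_unique _ l1 l2; first by rewrite mulrC divfK// gt_eqF.
Unshelve. all: by end_near. Qed.

End ScalarCalculus.

(** * Calculus in a finite-dimensional real algebra *)

Section RealAlgebra.
Variables (R : realType) (K : finType) (M : K -> K -> K -> R).
Implicit Types (x y z : K -> R) (a b c t u v : R) (f g : R -> K -> R).

(** Only bilinearity is built in; commutativity, associativity and the unit enter as hypotheses of
    later sections. *)
Definition amul x y : K -> R := fun k => \sum_r \sum_s x r * y s * M r s k.

Lemma amulDl x y z : amul (x + y) z = amul x z + amul y z.
Proof.
apply/funext => k; rewrite /amul !fctE /= -big_split /=; apply: eq_bigr => r _.
by rewrite -big_split /=; apply: eq_bigr => s _; rewrite !mulrDl.
Qed.

Lemma amulDr x y z : amul x (y + z) = amul x y + amul x z.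
Proof.
apply/funext => k; rewrite /amul !fctE /= -big_split /=; apply: eq_bigr => r _.
by rewrite -big_split /=; apply: eq_bigr => s _; rewrite mulrDr mulrDl.
Qed.

Lemma amulZl c x y : amul (c *: x) y = c *: amul x y.
Proof.
apply/funext => k; rewrite -[RHS]/(c * amul x y k) /amul mulr_sumr.
apply: eq_bigr => r _; rewrite mulr_sumr.
by apply: eq_bigr => s _; rewrite !mulrA.
Qed.

Lemma amulZr c x y : amul x (c *: y) = c *: amul x y.
Proof.
apply/funext => k; rewrite -[RHS]/(c * amul x y k) /amul mulr_sumr.
apply: eq_bigr => r _; rewrite mulr_sumr.
by apply: eq_bigr => s _; rewrite -[(c *: y) s]/(c * y s) !mulrA [x r * c]mulrC.
Qed.

Lemma amulNl x y : amul (- x) y = - amul x y.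
Proof.
apply/funext => k; rewrite -[RHS]/(- amul x y k) /amul -sumrN.
apply: eq_bigr => r _; rewrite -sumrN; apply: eq_bigr => s _.
by rewrite -[(- x) r]/(- x r) !mulNr.
Qed.

Lemma amulNr x y : amul x (- y) = - amul x y.
Proof.
apply/funext => k; rewrite -[RHS]/(- amul x y k) /amul -sumrN.
apply: eq_bigr => r _; rewrite -sumrN; apply: eq_bigr => s _.
by rewrite -[(- y) s]/(- y s) mulrN mulNr.
Qed.

Lemma amul0l y : amul 0 y = 0.
Proof.
apply/funext => k; rewrite /amul big1 // => r _; rewrite big1 // => s _.
by rewrite !mul0r.
Qed.

Lemma amul0r x : amul x 0 = 0.
Proof.
apply/funext => k; rewrite /amul big1 // => r _; rewrite big1 // => s _.
by rewrite mulr0 mul0r.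
Qed.

Definition acvg (T : Type) (F : set_system T) (f : T -> K -> R) (l : K -> R) :=
  forall k, (fun s => f s k) @ F --> l k.

Lemma acvgM (T : Type) (F : set_system T) (f g : T -> K -> R) (l l' : K -> R) :
  Filter F -> acvg F f l -> acvg F g l' ->
  acvg F (fun s => amul (f s) (g s)) (amul l l').
Proof.
move=> FF fl gl k; apply: (cvg_big add_continuous) => r _.
apply: (cvg_big add_continuous) => s _.
by apply: cvgMl; apply: cvgM; [exact: fl|exact: gl].
Qed.

Definition acont (f : R -> K -> R) := forall k, continuous (fun t => f t k).

Lemma acont_cst x : acont (fun=> x).
Proof. by move=> k t; apply: cvg_cst. Qed.

Lemma acontM f g : acont f -> acont g -> acont (fun t => amul (f t) (g t)).
Proof.
by move=> cf cg k t; apply: acvgM => {}k; [exact: cf|exact: cg].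
Qed.

Definition aderiv (f : R -> K -> R) t (d : K -> R) :=
  forall k, is_derive t 1 (fun t => f t k) (d k).

Lemma aderiv_slope f t d :
  aderiv f t d <-> acvg 0^' (fun h : R => h^-1 *: (f (h + t) - f t)) d.
Proof. by split=> fd k; apply/(is_derive_slope (fun t => f t k)); exact: fd k. Qed.

Lemma aderiv_cont f d : (forall t, aderiv f t (d t)) -> acont f.
Proof. by move=> fd k t; exact: is_derive_continuous (fd t k). Qed.

Lemma aderiv_cst x t : aderiv (fun=> x) t 0.
Proof. by move=> k; exact: is_derive_cst. Qed.

Lemma aderivM f g t df dg : aderiv f t df -> aderiv g t dg ->
  aderiv (fun t => amul (f t) (g t)) t (amul df (g t) + amul (f t) dg).
Proof.
move=> fd gd k.
have -> : (amul df (g t) + amul (f t) dg) k = \sum_r \sum_s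
   (df r * g t s + f t r * dg s) * M r s k.
  rewrite /amul !fctE -big_split /=; apply: eq_bigr => r _.
  by rewrite -big_split /=; apply: eq_bigr => s _; rewrite -mulrDl.
apply: is_derive_fsum => r; apply: is_derive_fsum => s.
have := is_derive_fmul (is_derive_fmul (fd r) (gd s)) (is_derive_cst (M r s k) t 1).
by rewrite mulr0 addr0.
Qed.

Definition aint a b (f : R -> K -> R) : K -> R :=
  fun k => \int[lebesgue_measure]_(t in `[a, b]) f t k.

Lemma aintM a b x f : acont f ->
  aint a b (fun t => amul x (f t)) = amul x (aint a b f).
Proof.
move=> cf; apply/funext => k.
have cfs r s : continuous (fun t => x r * f t s * M r s k).
  move=> t; apply: cvgMl; apply: cvgMr; exact: cf.
rewrite /aint /amul Rintegral_sum => [|r]; last first.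
  by apply: continuous_big => [|s _]; [exact: add_continuous|exact: cfs].
apply: eq_bigr => r _; rewrite Rintegral_sum //; apply: eq_bigr => s _.
under eq_Rintegral do rewrite mulrAC.
rewrite (RintegralZl _ _ (continuous_integrable _ _ (cf s))); last exact: measurable_itv.
by rewrite mulrAC.
Qed.

Lemma aintB a b f g : acont f -> acont g ->
  aint a b (fun t => f t - g t) = aint a b f - aint a b g.
Proof.
move=> cf cg; apply/funext => k.
apply: RintegralB; first exact: measurable_itv.
- exact: continuous_integrable _ _ (cf k).
- exact: continuous_integrable _ _ (cg k).
Qed.

Lemma aintFTC a b f d : a < b -> (forall t, aderiv f t (d t)) -> acont d ->
  aint a b d = f b - f a.
Proof.
move=> ab fd cd; apply/funext => k.
exact: (@FTC2 R (fun t => d t k) (fun t => f t k) a b ab (cd k) (fun t => fd t k)).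
Qed.

Lemma aderiv_aint (f df : R -> R -> K -> R) a b u v C :
  (forall t, u < t < v -> acont (f t)) ->
  (forall t s, u < t < v -> aderiv (f ^~ s) t (df t s)) ->
  (forall t s k, u < t < v -> a <= s <= b -> `|df t s k| <= C) ->
  forall t, u < t < v -> aderiv (fun t => aint a b (f t)) t (aint a b (df t)).
Proof.
move=> cf fd dC t tuv k.
apply: (@is_derive_Rintegral R (fun t s => f t s k) (fun t s => df t s k) a b u v C) => //.
- by move=> s suv; exact: cf _ suv k.
- by move=> r s ruv; exact: fd _ _ ruv k.
- by move=> r s ruv sab; exact: dC.
Qed.

Lemma aint_eq a b f g : f =1 g -> aint a b f = aint a b g.
Proof. by move=> /funext ->. Qed.

Definition anorm x := \sum_k `|x k|.

Lemma le_anorm x k : `|x k| <= anorm x.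
Proof. by rewrite /anorm (bigD1 k)//= lerDl sumr_ge0. Qed.

Lemma anorm_ge0 x : 0 <= anorm x.
Proof. exact: sumr_ge0. Qed.

Lemma anormD x y : anorm (x + y) <= anorm x + anorm y.
Proof. by rewrite -big_split ler_sum// => k _; exact: ler_normD. Qed.

Lemma anormN x : anorm (- x) = anorm x.
Proof. by apply: eq_bigr => k _; rewrite normrN. Qed.

(** The sum of all [|M r s k|] serves as the constant, because each coordinate is at most the
    norm. *)
Lemma anormM : exists2 C, 0 <= C & forall x y, anorm (amul x y) <= C * anorm x * anorm y.
Proof.
exists (\sum_k \sum_r \sum_s `|M r s k|) => [|x y]; first by do 3!apply: sumr_ge0 => ? _.
rewrite -mulrA mulr_suml; apply: ler_sum => k _.
rewrite (le_trans (ler_norm_sum _ _ _))// mulr_suml; apply: ler_sum => r _.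
rewrite (le_trans (ler_norm_sum _ _ _))// mulr_suml; apply: ler_sum => s _.
rewrite !normrM mulrC ler_wpM2l// ler_pM//; exact: le_anorm.
Qed.

Lemma acont_anorm f : acont f -> continuous (fun t => anorm (f t)).
Proof.
move=> cf; apply: continuous_big => [|k _]; first exact: add_continuous.
by move=> t; apply: cvg_norm; exact: cf.
Qed.

Lemma acvg_anorm (T : Type) (F : set_system T) (f : T -> K -> R) (l : K -> R) :
  Filter F -> acvg F f l <-> (fun s => anorm (f s - l)) @ F --> 0.
Proof.
move=> FF; split=> [fl|fl k].
  have -> : (0 : R) = \sum_(k : K) 0 by rewrite big1.
  apply: (cvg_big add_continuous) => k _.
  have <- : `|l k - l k| = 0 by rewrite subrr normr0.
  by apply: cvg_norm; apply: cvgB; [exact: fl|exact: cvg_cst].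
apply/subr_cvg0; apply: norm_cvg0.
apply: (@squeeze_cvgr _ _ _ _ (cst 0) _ _ _ _ _ fl); last exact: cvg_cst.
by apply: nearW => s /=; rewrite normr_ge0 (le_anorm (f s - l) k).
Qed.

End RealAlgebra.

(** * Boxes in R^3 and inverses *)

Section Box.
Variable R : realType.
Implicit Types p q A B : pt R.

(** An open cube, that is, a ball of the product metric on [pt]. Its convexity keeps segments and
    triangles inside. *)
Definition box p (r : R) : set (pt R) := [set q |
  [/\ `|px q - px p| < r, `|py q - py p| < r & `|pz q - pz p| < r]].

Lemma nbhs_box p (P : set (pt R)) :
  nbhs p P -> exists2 r, 0 < r & box p r `<=` P.
Proof.
move=> /nbhs_ballP[r /= r0 rP]; exists r => // q [hx hy hz].
apply: rP; split; [split|] => /=; rewrite /ball/= distrC.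
- exact: hx.
- exact: hy.
- exact: hz.
Qed.

Lemma box_center p r : 0 < r -> box p r p.
Proof. by move=> r0; split; rewrite subrr normr0. Qed.

Lemma lt_norm_convex (a b c r t : R) : 0 <= t <= 1 ->
  `|a - c| < r -> `|b - c| < r -> `|a + t * (b - a) - c| < r.
Proof.
move=> /andP[t0 t1] ac bc.
have -> : a + t * (b - a) - c = (1 - t) * (a - c) + t * (b - c) by ring.
rewrite (le_lt_trans (ler_normD _ _))// !normrM (ger0_norm t0) ger0_norm ?subr_ge0//.
(* For [t = 0] the bound on [b] carries weight zero and cannot give strictness; the bound on [a]
   alone then suffices. *)
have [t_gt0|t_le0] := ltP 0 t; last by have -> : t = 0; [lra|rewrite subr0 mul1r mul0r addr0].
have H1 : 0 <= (1 - t) * (r - `|a - c|) by rewrite mulr_ge0 ?subr_ge0// ltW.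
have H2 : 0 < t * (r - `|b - c|) by rewrite mulr_gt0 ?subr_gt0.
lra.
Qed.

Lemma box_seg p r A B t : 0 <= t <= 1 -> box p r A -> box p r B ->
  box p r (seg A B t).
Proof.
by move=> t01 [? ? ?] [? ? ?]; split; rewrite /seg /px/py/pz/=; exact: lt_norm_convex.
Qed.

Lemma box_cvg (T : Type) (F : set_system T) (s : T -> pt R) A r :
  Filter F -> 0 < r ->
  (fun i => px (s i)) @ F --> px A -> (fun i => py (s i)) @ F --> py A ->
  (fun i => pz (s i)) @ F --> pz A -> \forall i \near F, box A r (s i).
Proof.
move=> FF r0 /cvgrPdist_lt/(_ _ r0) hx /cvgrPdist_lt/(_ _ r0) hy /cvgrPdist_lt/(_ _ r0) hz.
by near=> i; split; rewrite distrC; near: i.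
Unshelve. all: by end_near. Qed.

Lemma cvg_pt (T : Type) (F : set_system T) (s : T -> pt R) A :
  Filter F ->
  (fun i => px (s i)) @ F --> px A -> (fun i => py (s i)) @ F --> py A ->
  (fun i => pz (s i)) @ F --> pz A -> s @ F --> A.
Proof.
move=> FF hx hy hz P /nbhs_box[r r0 rP].
by apply: filterS (box_cvg FF r0 hx hy hz) => i; exact: rP.
Qed.

Lemma continuous_px : continuous (@px R).
Proof. move=> A; exact: (@cvg_comp _ _ _ fst fst _ _ _ cvg_fst cvg_fst). Qed.

Lemma continuous_py : continuous (@py R).
Proof. move=> A; exact: (@cvg_comp _ _ _ fst snd _ _ _ cvg_fst cvg_snd). Qed.

Lemma continuous_pz : continuous (@pz R).
Proof. move=> A; exact: cvg_snd. Qed.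

Lemma open_box p r A : box p r A -> nbhs A (box p r).
Proof.
have aux (f : pt R -> R) c : {for A, continuous f} -> `|f A - c| < r ->
    \forall q \near A, `|f q - c| < r.
  move=> fA fr; have : (fun q => `|f q - c|) @ A --> `|f A - c|.
    by apply: cvg_norm; apply: cvgB => //; exact: cvg_cst.
  by move/cvgr_lt; apply.
case=> /(aux _ _ (@continuous_px A)) bx /(aux _ _ (@continuous_py A)) by'.
move=> /(aux _ _ (@continuous_pz A)) bz.
by near=> q; split; near: q.
Unshelve. all: by end_near. Qed.

Lemma seg_rev A B t : seg B A t = seg A B (1 - t).
Proof. by rewrite /seg; congr (_, _, _); ring. Qed.

Lemma pt_eq p q : px p = px q -> py p = py q -> pz p = pz q -> p = q.
Proof. by case: p => [[? ?] ?]; case: q => [[? ?] ?]; rewrite /px/py/pz/= => -> -> ->. Qed.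

Definition pt_deriv (s : R -> pt R) (t : R) d :=
  [/\ is_derive t 1 (fun x => px (s x)) (px d),
      is_derive t 1 (fun x => py (s x)) (py d) &
      is_derive t 1 (fun x => pz (s x)) (pz d)].

Lemma pt_deriv_cst p t : pt_deriv (fun=> p) t 0.
Proof. by split; exact: is_derive_cst. Qed.

Lemma pt_derivD (s s' : R -> pt R) (t : R) d d' :
  pt_deriv s t d -> pt_deriv s' t d' -> pt_deriv (fun x => s x + s' x) t (d + d').
Proof. by move=> [? ? ?] [? ? ?]; split; exact: is_deriveD. Qed.

Lemma pt_derivZ (c : R -> R) (s : R -> pt R) (t : R) dc d :
  is_derive t 1 c dc -> pt_deriv s t d ->
  pt_deriv (fun x => c x *: s x) t (dc *: s t + c t *: d).
Proof. by move=> ? [? ? ?]; split; exact: is_derive_fmul. Qed.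

Lemma pt_deriv_continuous (s : R -> pt R) (d : R -> pt R) :
  (forall t, pt_deriv s t (d t)) -> continuous s.
Proof.
by move=> sd t; case: (sd t) => ? ? ?; apply: cvg_pt; apply: is_derive_continuous.
Qed.

End Box.

(** * Continuity and differentiation of inverses in the algebra *)

Section Inverse.
Variables (R : realType) (K : finType) (M : K -> K -> K -> R).
Local Notation "x ** y" := (amul M x y) (at level 40, left associativity).
Variable one : K -> R.
Hypothesis amulC : forall x y, x ** y = y ** x.
Hypothesis amulA : forall x y z, x ** (y ** z) = (x ** y) ** z.
Hypothesis amul1 : forall x, one ** x = x.

(** Expanding [y' y (x' - x)] and cancelling [x y] and [x' y'] leaves [y - y']. Differences of
    inverses are thus controlled by differences of the elements. *)
Lemma resolvent (x x' y y' : K -> R) : x ** y = one -> x' ** y' = one ->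
  y' - y = - ((y' ** y) ** (x' - x)).
Proof.
move=> xy xy'; rewrite amulDr amulNr -[y' ** y ** x]amulA [y ** x]amulC xy.
rewrite [y' ** y]amulC -[y ** y' ** x']amulA [y' ** x']amulC xy'.
by rewrite [y ** one]amulC [y' ** one]amulC !amul1 opprB.
Qed.

(** No bound on [l s] is known beforehand. The resolvent identity bounds the distance from [l s] to
    [y] by a small multiple of the norm of [l s], and absorbing that term yields the bound. *)
Lemma acvg_inv (T : Type) (F : set_system T) (g l : T -> K -> R) x y :
  Filter F -> (forall s, g s ** l s = one) -> x ** y = one ->
  acvg F g x -> acvg F l y.
Proof.
move=> FF gl xy /acvg_anorm gx; apply/acvg_anorm.
have [C C0 hC] := anormM M.
have n0 := anorm_ge0 y.
have gx' : (fun s => C * C * 2 * anorm y * anorm y * anorm (g s - x)) @ F --> 0.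
  by rewrite -(mulr0 (C * C * 2 * anorm y * anorm y)); apply: cvgMr.
apply: (@squeeze_cvgr _ _ _ _ (cst 0) _ _ _ _ _ gx'); last exact: cvg_cst.
(* Below this threshold the factor [C * C * anorm y * anorm (g s - x)] is at most 1/2; the [+ 1]
   excludes division by zero. *)
have e0 : 0 < (2 * (C * C * anorm y + 1))^-1.
  by rewrite invr_gt0 mulr_gt0// ltr_wpDl// !mulr_ge0.
near=> s.
have N0 := anorm_ge0 (g s - x).
have : `|0 - anorm (g s - x)| < (2 * (C * C * anorm y + 1))^-1.
  by near: s; move/cvgrPdist_lt : gx; apply.
rewrite sub0r normrN ger0_norm// -[X in _ < X]div1r ltr_pdivlMr; last first.
  by rewrite mulr_gt0// ltr_wpDl// !mulr_ge0.
move=> Ns; rewrite /= anorm_ge0 /=.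
have := hC (l s ** y) (g s - x).
rewrite -anormN -(resolvent xy (gl s)) => D1.
have D2 := hC (l s) y.
have D3 : anorm (l s) <= anorm (l s - y) + anorm y.
  by have := anormD (l s - y) y; rewrite subrK.
have L0 := anorm_ge0 (l s).
set L := anorm (l s) in D2 D3 L0 *; set D := anorm (l s - y) in D1 D3 *.
set N := anorm (g s - x) in Ns D1 N0 *; set n := anorm y in n0 Ns D2 D3 *.
set P := anorm (l s ** y) in D1 D2.
have D4 : D <= C * (C * L * n) * N.
  by apply: le_trans D1 _; rewrite ler_wpM2r// ler_wpM2l.
have k0 : 0 <= C * C * n * N by rewrite !mulr_ge0.
have k1 : C * C * n * N <= 2^-1.
  rewrite (_ : N * (2 * (C * C * n + 1)) = 2 * (C * C * n * N) + 2 * N) in Ns; last by ring.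
  lra.
have -> : C * C * 2 * n * n * N = (C * C * n * N) * (2 * n) by ring.
have E : C * (C * L * n) * N = (C * C * n * N) * L by ring.
rewrite {}E in D4; move: (C * C * n * N) k0 k1 D4 => k k0 k1 D4.
have k2 : k * L <= 2^-1 * L by rewrite ler_wpM2r.
(* From [L <= D + n] and [D <= L / 2]. *)
have L2 : L <= 2 * n by lra.
by apply: le_trans D4 _; rewrite ler_wpM2l.
Unshelve. all: by end_near. Qed.

(** The resolvent identity, divided by [h], rewrites the difference quotient of [l] as a product of
    convergent factors. *)
Lemma aderiv_inv (g l : R -> K -> R) t dg :
  (forall s, g s ** l s = one) -> aderiv g t dg ->
  aderiv l t (- (dg ** (l t ** l t))).
Proof.
move=> gl gd; have gc k : {for t, continuous (fun s => g s k)}.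
  exact: is_derive_continuous (gd k).
apply/aderiv_slope.
have lc : acvg 0^' (fun h => l (h + t)) (l t).
  apply: (@acvg_inv _ _ (fun h => g (h + t)) _ (g t)) => // k.
  have : (fun h : R => h + t) @ 0^' --> t.
    rewrite -[X in _ --> X]add0r; apply: cvgD; last exact: cvg_cst.
    exact: cvg_within.
  by move=> ht; apply: (cvg_comp (fun h : R => h + t) (fun s => g s k) ht); exact: gc.
have -> : (fun h : R => h^-1 *: (l (h + t) - l t)) =
    (fun h => - ((l (h + t) ** l t) ** (h^-1 *: (g (h + t) - g t)))).
  by apply/funext => h; rewrite (resolvent (gl t) (gl (h + t))) amulZr scalerN.
rewrite [dg ** _]amulC => k; apply: cvgN.
apply: acvgM; last by move/aderiv_slope : gd.
by apply: acvgM => // j; exact: cvg_cst.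
Qed.

End Inverse.

(** * The local primitive *)

Section Primitive.
Variables (R : realType) (K : finType) (M : K -> K -> K -> R).
Local Notation "x ** y" := (amul M x y) (at level 40, left associativity).
Variables e1 e2 e3 : K -> R.
Implicit Types p q A B C D : pt R.

Definition zeta_real p : K -> R := px p *: e1 + py p *: e2 + pz p *: e3.

Lemma zeta_realE p k :
  zeta_real p k = px p * e1 k + py p * e2 k + pz p * e3 k.
Proof. by []. Qed.

Lemma zeta_realD p q : zeta_real (p + q) = zeta_real p + zeta_real q.
Proof. by apply/funext => k; rewrite !fctE !zeta_realE /px/py/pz/=; ring. Qed.

Lemma zeta_realN p : zeta_real (- p) = - zeta_real p.
Proof. by apply/funext => k; rewrite !fctE !zeta_realE /px/py/pz/=; ring. Qed.

Lemma zeta_realZ (c : R) p : zeta_real (c *: p) = c *: zeta_real p.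
Proof.
apply/funext => k; rewrite -[RHS]/(c * zeta_real p k) !zeta_realE /px/py/pz/=.
by rewrite /GRing.scale/=; ring.
Qed.

Variable phi : pt R -> K -> R.
Hypothesis cphi : forall k, continuous (fun q => phi q k).

Definition seg_mean A B : K -> R := aint 0 1 (fun t => phi (seg A B t)).
(** The integral of [phi] against [dzeta] along the segment from [A] to [B]: there [dzeta] is the
    constant [zeta_real (B - A)] times [dt], and it factors out. *)
Definition edge A B : K -> R := zeta_real (B - A) ** seg_mean A B.

Lemma cont_seg A B : acont (fun t => phi (seg A B t)).
Proof.
move=> k t; apply: (cvg_comp (seg A B) (fun q => phi q k)); last exact: cphi.
by apply: cvg_pt; apply: cvgD (cvg_cst _) _; apply: cvgMl; exact: cvg_id.
Qed.

Lemma edge_rev A B : edge B A = - edge A B.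
Proof.
rewrite /edge -opprB zeta_realN amulNl; congr (- (_ ** _)); apply/funext => k.
rewrite /seg_mean /aint.
have c1 : {within `[0, 1], continuous (fun t => phi (seg A B t) k)}.
  exact: continuous_subspaceT (@cont_seg A B k).
rewrite (@Rintegration_by_substitution_onem _ _ 1 _ c1) ?lexx ?ler01//.
rewrite /unstable.onem subrr.
by apply: eq_Rintegral => t _; rewrite seg_rev.
Qed.

Lemma edge_refl A : edge A A = 0.
Proof.
rewrite /edge subrr (_ : zeta_real 0 = 0) ?amul0l//.
by apply/funext => k; rewrite zeta_realE /px/py/pz/= !mul0r !addr0.
Qed.

(** A box around [A] on which [phi] is [e]-close to [phi A] contains, by convexity, the whole
    segment from [A] to [s i]. *)
Lemma seg_mean_cvg (T : Type) (F : set_system T) (s : T -> pt R) A :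
  Filter F -> s @ F --> A -> acvg F (fun i => seg_mean A (s i)) (phi A).
Proof.
move=> FF sA k; apply/cvgrPdist_le => e e0.
have /cvgrPdist_le/(_ _ e0)/nbhs_box[d d0 dP] := @cphi k A.
have /open_box := box_center A d0.
move=> /sA bs; near=> i.
have Asi : box A d (s i) by near: i; exact: bs.
have -> : phi A k = \int[lebesgue_measure]_(t in `[0, 1]) phi A k
  by rewrite Rintegral_cst_itv// subr0 mulr1.
rewrite -RintegralB //.
- apply: le_trans (@Rintegral_bound R _ 0 1 e _ _ _) _ => //.
  + by move=> t; apply: cvgB; [exact: cvg_cst|exact: cont_seg].
  + by move=> t t01; apply: dP; apply: box_seg => //; exact: box_center.
  + by rewrite subr0 mulr1.
- by apply: continuous_integrable => t; exact: cvg_cst.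
- exact: continuous_integrable _ _ (@cont_seg A (s i) k).
Unshelve. all: by end_near. Qed.

Variables (p0 : pt R) (r : R).
Hypothesis tri0 : forall A B C, box p0 r A -> box p0 r B -> box p0 r C ->
  nondeg_triangle A B C -> edge A B + edge B C + edge C A = 0.

(* If A, B, C are collinear, all three edges are taken to a common point D off the line. *)
Lemma edge_collinear (v A : pt R) (s t : R) : v <> 0 ->
  box p0 r A -> box p0 r (A + s *: v) -> box p0 r (A + t *: v) ->
  edge A (A + s *: v) + edge (A + s *: v) (A + t *: v) + edge (A + t *: v) A = 0.
Proof.
move=> v0 bA bB bC.
(* A coordinate vector independent of [v]: the first one if [px v = 0], otherwise the second. *)
have [w wv] : exists w : pt R, forall a b : R,
    a * px v + b * px w = 0 -> a * py v + b * py w = 0 ->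
    a * pz v + b * pz w = 0 -> a = 0 /\ b = 0.
  have [vx|vx] := eqVneq (px v) 0.
    exists (1, 0, 0) => a b; rewrite /px/py/pz/= -/(px v) -/(py v) -/(pz v) vx.
    rewrite !mulr0 !addr0 mulr1 add0r => -> ay az; split=> //.
    apply: contra_notP v0 => /eqP a0; apply: pt_eq => //; apply/eqP.
    - by move/eqP: ay; rewrite mulf_eq0 (negPf a0).
    - by move/eqP: az; rewrite mulf_eq0 (negPf a0).
  exists (0, 1, 0) => a b; rewrite /px/py/pz/= -/(px v) -/(py v) -/(pz v).
  rewrite !mulr0 !addr0 mulr1 => /eqP; rewrite mulf_eq0 (negPf vx) orbF => /eqP -> .
  by rewrite mul0r add0r.
have [d d0 bD] : exists2 d : R, d != 0 & box p0 r (A + d *: w).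
  have cD : (fun d : R => A + d *: w) @ 0^' --> A.
    have c0 (a b : R) : (fun d : R => a + d * b) @ 0^' --> a.
      have {2}<- : a + 0 * b = a by rewrite mul0r addr0.
      apply: cvgD (cvg_cst _) _.
      by apply: cvgMl; exact: cvg_within.
    by apply: cvg_pt; [exact: (c0 _ (px w))|exact: (c0 _ (py w))|exact: (c0 _ (pz w))].
  have : \forall d \near (0:R)^', d != 0 /\ box p0 r (A + d *: w).
    have bd := cD _ (open_box bA).
    by near=> d; split; near: d; [exact: nbhs_dnbhs_neq|exact: bd].
  by move=> /filter_ex[d []]; exists d.

move: bD; set D := A + d *: w => bD.
have indep a b : a *: v + b *: w = 0 -> a = 0 /\ b = 0.
  by move=> E; apply: wv; [move: (congr1 px E)|move: (congr1 py E)|move: (congr1 pz E)].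
(* For [x != y] the triangle with apex [D] is nondegenerate, since [D] is off the line; for [x = y]
   the two edges to [D] cancel by reversal. *)
have triD x y : box p0 r (A + x *: v) -> box p0 r (A + y *: v) ->
    edge (A + x *: v) (A + y *: v) + edge (A + y *: v) D + edge D (A + x *: v) = 0.
  have [->|xy] := eqVneq x y.
    by move=> _ _; rewrite edge_refl add0r [edge D _]edge_rev subrr.
  move=> bx by'; apply: tri0 => // a b hx hy hz.
  have : (a * (y - x) - b * x) *: v + (b * d) *: w = 0.
    apply: pt_eq.
    - by rewrite -[RHS]hx /D /px/py/pz/= /GRing.scale/=; ring.
    - by rewrite -[RHS]hy /D /px/py/pz/= /GRing.scale/=; ring.
    - by rewrite -[RHS]hz /D /px/py/pz/= /GRing.scale/=; ring.
  move=> /indep[+ /eqP]; rewrite mulf_eq0 (negPf d0) orbF => /[swap] /eqP ->.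
  rewrite mul0r subr0 => /eqP; rewrite mulf_eq0 subr_eq0 [y == x]eq_sym (negPf xy) orbF.
  by move=> /eqP.
have bA' : box p0 r (A + 0 *: v) by rewrite scale0r addr0.
have H1 := triD 0 s bA' bB; have H2 := triD s t bB bC; have H3 := triD t 0 bC bA'.
rewrite scale0r addr0 in H1 H3.
move: H1 H2 H3; rewrite [edge D A]edge_rev.
rewrite [edge D (A + s *: v)]edge_rev [edge D (A + t *: v)]edge_rev.
move: (edge A (A + s *: v)) (edge (A + s *: v) (A + t *: v)) (edge (A + t *: v) A).
move: (edge (A + s *: v) D) (edge A D) (edge (A + t *: v) D) => {}bA a' b' x y z H1 H2 H3.
apply/funext => k; move: (congr1 (@^~ k) H1) (congr1 (@^~ k) H2) (congr1 (@^~ k) H3).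
change (x k + bA k - a' k = 0 -> y k + b' k - bA k = 0 -> z k + a' k - b' k = 0 ->
  x k + y k + z k = 0); lra.
Unshelve. all: by end_near. Qed.

(** The hypothesis on triangles concerns nondegenerate ones only, while comparing values of the
    primitive also involves points collinear with the base point. A nontrivial relation between
    [B - A] and [C - A] puts the vertices on one line. *)
Lemma edge_triangle A B C : box p0 r A -> box p0 r B -> box p0 r C ->
  edge A B + edge B C + edge C A = 0.
Proof.
move=> bA bB bC; have [|/existsNP[s /existsNP[t]]] := pselect (nondeg_triangle A B C).
  exact: tri0.
move=> /not_implyP[hx /not_implyP[hy /not_implyP[hz st]]].
have H : s *: (B - A) + t *: (C - A) = 0 by apply: pt_eq.
have edges0 P : edge P P + edge P P + edge P P = 0 by rewrite edge_refl !addr0.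
have [t0|t0] := eqVneq t 0.
  have s0 : s != 0 by apply/eqP => s0; apply: st.
  have -> : B = A.
    apply/eqP; rewrite -subr_eq0; move/eqP: H; rewrite t0 scale0r addr0 scaler_eq0.
    by rewrite (negPf s0).
  have [->|/eqP CA] := eqVneq C A; first exact: edges0.
  have CA0 : C - A <> 0 by move=> /eqP; rewrite subr_eq0 => /eqP.
  have := @edge_collinear (C - A) A 0 1 CA0.
  by rewrite scale0r scale1r addr0 addrC subrK; apply.
have EC : C = A + (- (s / t)) *: (B - A).
  apply/eqP; rewrite addrC -subr_eq; apply/eqP.
  apply: (scalerI t0); rewrite scalerA mulrN mulrCA divff// mulr1 scaleNr.
  by apply/eqP; rewrite -addr_eq0 addrC; apply/eqP.
have [BA|/eqP BA] := eqVneq B A.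
  by move: EC; rewrite BA subrr scaler0 addr0 => ->; exact: edges0.
have BA0 : B - A <> 0 by move=> /eqP; rewrite subr_eq0 => /eqP.
have := @edge_collinear (B - A) A 1 (- (s / t)) BA0.
by rewrite -EC scale1r addrC subrK; apply.
Qed.

Definition primitive q : K -> R := edge p0 q.

Hypothesis r0 : 0 < r.

Lemma primitiveB A B : box p0 r A -> box p0 r B ->
  primitive B - primitive A = edge A B.
Proof.
move=> bA bB; have := edge_triangle (box_center p0 r0) bA bB.
rewrite [edge B p0]edge_rev => /eqP; rewrite subr_eq0 => /eqP E.
by rewrite /primitive -E addrAC subrr add0r.
Qed.

(** By [primitiveB] the difference quotient is the image under [zeta_real] of the chord divided by
    [h], times the mean of [phi] over the chord; both factors converge. Stating it along curves
    serves differentiation in the parameter as well as along the ellipse. *)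
Lemma primitive_deriv (s : R -> pt R) t (d : pt R) : box p0 r (s t) ->
  pt_deriv s t d ->
  aderiv (fun x => primitive (s x)) t (zeta_real d ** phi (s t)).
Proof.
move=> bs [dx dy dz]; apply/aderiv_slope.
have shift0 : (fun h : R => h + t) @ 0^' --> t.
  rewrite -[X in _ --> X]add0r; apply: cvgD; last exact: cvg_cst.
  exact: cvg_within.
have sc : (fun h : R => s (h + t)) @ 0^' --> s t.
  apply: cvg_pt.
  - exact: (cvg_comp _ _ shift0 (is_derive_continuous dx)).
  - exact: (cvg_comp _ _ shift0 (is_derive_continuous dy)).
  - exact: (cvg_comp _ _ shift0 (is_derive_continuous dz)).
have E : \forall h \near (0 : R)^',
    zeta_real (h^-1 *: (s (h + t) - s t)) ** seg_mean (s t) (s (h + t)) =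
    h^-1 *: (primitive (s (h + t)) - primitive (s t)).
  have bd := sc _ (open_box bs).
  near=> h; rewrite primitiveB //; last by near: h; exact: bd.
  by rewrite zeta_realZ amulZl.
move=> k.
apply: cvg_trans (_ : (fun h : R => (zeta_real (h^-1 *: (s (h + t) - s t)) **
   seg_mean (s t) (s (h + t))) k) @ 0^' --> _).
  by apply: near_eq_cvg; near=> h; congr (_ k); near: h.
apply: acvgM; last exact: seg_mean_cvg.
move=> {}k; rewrite /zeta_real.
have := (is_derive_slope _ _ _).1 dx; have := (is_derive_slope _ _ _).1 dy.
have := (is_derive_slope _ _ _).1 dz => sz sy sx.
apply: cvgD; [apply: cvgD|]; apply: cvgMl.
- exact: sx.
- exact: sy.
- exact: sz.
Unshelve. all: by end_near. Qed.

End Primitive.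

(** * The Cauchy-type formula *)

Section Regularity.
Variables (R : realType) (K : finType) (M : K -> K -> K -> R).
Local Notation "x ** y" := (amul M x y) (at level 40, left associativity).
Variable one : K -> R.
Hypothesis amulC : forall x y, x ** y = y ** x.
Hypothesis amulA : forall x y z, x ** (y ** z) = (x ** y) ** z.
Hypothesis amul1 : forall x, one ** x = x.
Variables e1 e2 e3 : K -> R.
Local Notation zeta := (zeta_real e1 e2 e3).
Variables h1 h2 : pt R.

(** The ellipse gamma, with axes [h1] and [h2] left arbitrary for now. Below, [lam] is a choice of
    gamma^-1 and [cinv] inverts the winding integral c. *)
Definition circ (t : R) : pt R := cos t *: h1 + sin t *: h2.
Definition dcirc (t : R) : pt R := - sin t *: h1 + cos t *: h2.

Variables (lam : R -> K -> R) (cinv : K -> R).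
Hypothesis lamP : forall t, zeta (circ t) ** lam t = one.
Local Notation T := (pi *+ 2 : R).
Hypothesis cinvP : aint 0 T (fun t => zeta (dcirc t) ** lam t) ** cinv = one.

Lemma pt_deriv_circ t : pt_deriv circ t (dcirc t).
Proof.
have := pt_derivD (pt_derivZ (is_derive_cos t) (pt_deriv_cst h1 t))
                  (pt_derivZ (is_derive_sin t) (pt_deriv_cst h2 t)).
by rewrite !scaler0 !addr0.
Qed.

Lemma pt_deriv_dcirc t : pt_deriv dcirc t (- circ t).
Proof.
have := pt_derivD (pt_derivZ (is_deriveN (is_derive_sin t)) (pt_deriv_cst h1 t))
                  (pt_derivZ (is_derive_cos t) (pt_deriv_cst h2 t)).
by rewrite !scaler0 !addr0 /circ opprD -!scaleNr.
Qed.

Lemma aderiv_zeta (s : R -> pt R) t d :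
  pt_deriv s t d -> aderiv (fun x => zeta (s x)) t (zeta d).
Proof.
move=> [dx dy dz] k; rewrite /zeta_real.
have H (f : R -> R) df (e : K -> R) : is_derive t 1 f df ->
    is_derive t 1 (fun x => f x * e k) (df * e k).
  move=> fd; have := is_derive_fmul fd (is_derive_cst (e k) t 1).
  by rewrite mulr0 addr0.
exact: is_deriveD (is_deriveD (H _ _ e1 dx) (H _ _ e2 dy)) (H _ _ e3 dz).
Qed.

Definition kap t : K -> R := zeta (dcirc t) ** (lam t ** lam t).

Lemma aderiv_lam t : aderiv lam t (- kap t).
Proof. exact: aderiv_inv (aderiv_zeta (pt_deriv_circ t)). Qed.

Lemma acont_lam : acont lam.
Proof. exact: aderiv_cont aderiv_lam. Qed.

Lemma acont_dcirc : acont (fun t => zeta (dcirc t)).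
Proof. exact: aderiv_cont (fun t => aderiv_zeta (pt_deriv_dcirc t)). Qed.

Lemma acont_kap : acont kap.
Proof.
by apply: acontM; [exact: acont_dcirc|apply: acontM; exact: acont_lam].
Qed.

(** Here gamma kappa = gamma' gamma^-1: one of the two factors gamma^-1 in kappa is cancelled. *)
Lemma circ_kap t : zeta (circ t) ** kap t = zeta (dcirc t) ** lam t.
Proof.
by rewrite /kap amulA [zeta (circ t) ** _]amulC -amulA [zeta (circ t) ** (_ ** _)]amulA lamP amul1.
Qed.

Lemma circ2pi : circ T = circ 0.
Proof. by rewrite /circ cos2pi sin2pi cos0 sin0. Qed.

(** [lam] is known only through [lamP], so its periodicity comes from uniqueness of inverses, read
    off the resolvent identity. *)
Lemma lam2pi : lam T = lam 0.
Proof.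
apply/eqP; rewrite -subr_eq0; apply/eqP.
by rewrite (resolvent amulC amulA amul1 (lamP 0) (lamP T)) circ2pi subrr amul0r oppr0.
Qed.

Variable phi : pt R -> K -> R.
Hypothesis cphi : forall k, continuous (fun q => phi q k).
Variable Cphi : R.
Hypothesis phi_bound : forall q, anorm (phi q) <= Cphi.
Variables (p0 : pt R) (r : R).
Hypothesis r0 : 0 < r.
Hypothesis tri0 : forall A B C, box p0 r A -> box p0 r B -> box p0 r C ->
  nondeg_triangle A B C ->
  edge M e1 e2 e3 phi A B + edge M e1 e2 e3 phi B C + edge M e1 e2 e3 phi C A = 0.

Local Notation F := (primitive M e1 e2 e3 phi p0).

Lemma aderiv_F (s : R -> pt R) t d : box p0 r (s t) -> pt_deriv s t d ->
  aderiv (fun x => F (s x)) t (zeta d ** phi (s t)).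
Proof. exact: (primitive_deriv cphi tri0 r0). Qed.

Lemma acont_phi (s d : R -> pt R) : (forall t, pt_deriv s t (d t)) ->
  acont (fun t => phi (s t)).
Proof.
move=> sd k t; apply: (cvg_comp s (fun q => phi q k)); last exact: cphi.
exact: pt_deriv_continuous sd t.
Qed.

Lemma pi2_gt0 : 0 < T.
Proof. by rewrite mulrn_wgt0// pi_gt0. Qed.

(** This serves two differentiations: in the radius, with [w] constant and [u] the ellipse, and in
    the centre, with [w] the translated ellipse and [u] a constant direction. *)
Lemma aderiv_smear (w u dw du : R -> pt R) a b :
  (forall x, pt_deriv w x (dw x)) -> (forall x, pt_deriv u x (du x)) ->
  (forall t x, a < t < b -> box p0 r (w x + t *: u x)) ->
  forall t, a < t < b ->
  aderiv (fun t => aint 0 T (fun x => F (w x + t *: u x) ** kap x)) t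
    (aint 0 T (fun x => (zeta (u x) ** phi (w x + t *: u x)) ** kap x)).
Proof.
move=> wd ud wu.
have sd t x : pt_deriv (fun x => w x + t *: u x) x (dw x + t *: du x).
  have := pt_derivD (wd x) (pt_derivZ (is_derive_cst t x 1) (ud x)).
  by rewrite scale0r add0r.
have td t x : pt_deriv (fun t => w x + t *: u x) t (u x).
  have := pt_derivD (pt_deriv_cst (w x) t) (pt_derivZ (is_derive_id t 1) (pt_deriv_cst (u x) t)).
  by rewrite scaler0 addr0 scale1r add0r.
have cu : acont (fun x => zeta (u x)).
  exact: aderiv_cont (fun x => aderiv_zeta (ud x)).
have [C C0 hC] := anormM M.
have cb : {within `[0, T], continuous (fun x => anorm (zeta (u x)) * anorm (kap x))}.
  apply: continuous_subspaceT => x.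
  by apply: cvgM; apply: acont_anorm => //; exact: acont_kap.
(* The point [c] maximises the part of the bound that depends on [x]; the two products and the bound
   on [phi] contribute [C * C * Cphi]. *)
have [c _ cM] := EVT_max (ltW pi2_gt0) cb.
apply: (@aderiv_aint _ _ _ _ _ _ _ _ (C * C * Cphi * (anorm (zeta (u c)) * anorm (kap c)))).
- move=> t tab; apply: acontM; last exact: acont_kap.
  apply: (@aderiv_cont _ _ _ (fun x => zeta (dw x + t *: du x) ** phi (w x + t *: u x))).
  by move=> x; apply: aderiv_F; [exact: wu|exact: sd].
- move=> t x tab.
  have := aderivM M (aderiv_F (wu t x tab) (td t x)) (aderiv_cst (kap x) t).
  by rewrite amul0r addr0.
- move=> t x k tab xT; apply: le_trans (le_anorm _ _) _.
  apply: le_trans (hC _ _) _.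
  apply: (@le_trans _ _ (C * (C * anorm (zeta (u x)) * Cphi) * anorm (kap x))).
    rewrite ler_wpM2r ?anorm_ge0// ler_wpM2l//.
    by apply: le_trans (hC _ _) _; rewrite ler_wpM2l// mulr_ge0// anorm_ge0.
  have -> : C * (C * anorm (zeta (u x)) * Cphi) * anorm (kap x) =
      C * C * Cphi * (anorm (zeta (u x)) * anorm (kap x)) by ring.
  rewrite ler_wpM2l//; last by apply: cM; rewrite in_itv.
  by rewrite !mulr_ge0//; apply: le_trans (phi_bound p0); exact: anorm_ge0.
Qed.

Variable rho : R.
Hypothesis rho0 : 0 < rho.
Hypothesis rho_box : forall q t x, box p0 (r / 2) q -> - (2 * rho) < t < 2 * rho ->
  box p0 r (q + t *: circ x).

Lemma cauchy_formula q : box p0 (r / 2) q ->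
  aint 0 T (fun x => F (q + rho *: circ x) ** kap x) =
  rho *: (phi q ** aint 0 T (fun x => zeta (dcirc x) ** lam x)).
Proof.
move=> bq; set b := 2 * rho.
pose m t := aint 0 T (fun x => phi (q + t *: circ x) ** (zeta (dcirc x) ** lam x)).
pose H t := aint 0 T (fun x => F (q + t *: circ x) ** kap x).
have sd t x : pt_deriv (fun x => q + t *: circ x) x (t *: dcirc x).
  have := pt_derivD (pt_deriv_cst q x) (pt_derivZ (is_derive_cst t x 1) (pt_deriv_circ x)).
  by rewrite scale0r !add0r.
have cphis t : acont (fun x => phi (q + t *: circ x)) by exact: acont_phi (sd t).
have cdl : acont (fun x => zeta (dcirc x) ** lam x).
  by apply: acontM; [exact: acont_dcirc|exact: acont_lam].
(* Differentiation brings out a factor gamma, which [circ_kap] merges with kappa. *)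
have Hd t : - b < t < b -> aderiv H t (m t).
  move=> tb; have := @aderiv_smear (fun=> q) circ (fun=> 0) dcirc (- b) b
    (pt_deriv_cst q) pt_deriv_circ (fun t x => @rho_box q t x bq) t tb.
  congr (aderiv _ _ _); apply: aint_eq => x.
  by rewrite [zeta _ ** _]amulC -amulA circ_kap.
(* Integration by parts: F(q + t gamma) gamma^-1 takes the same value at both ends of the period, so
   its derivative integrates to zero. *)
have Hm t : - b < t < b -> H t = t *: m t.
  move=> tb; have Fd x := aderiv_F (rho_box x bq tb) (sd t x).
  have cF : acont (fun x => F (q + t *: circ x)) := aderiv_cont Fd.
  have := aintFTC pi2_gt0 (fun x => aderivM M (Fd x) (aderiv_lam x)) _.
  rewrite circ2pi lam2pi subrr => I0.
  (* The scalar [t] is written as the algebra element [t *: one] so that [aintM] can take it out of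
     the integral. *)
  have E : (fun x => zeta (t *: dcirc x) ** phi (q + t *: circ x) ** lam x +
      F (q + t *: circ x) ** - kap x) =
      (fun x => (t *: one) ** (phi (q + t *: circ x) ** (zeta (dcirc x) ** lam x)) -
        F (q + t *: circ x) ** kap x).
    apply/funext => x; rewrite amulNr zeta_realZ !amulZl amul1; congr (_ *: _ - _).
    by rewrite [zeta _ ** phi _]amulC amulA.
  have c1 : acont (fun x => phi (q + t *: circ x) ** (zeta (dcirc x) ** lam x)).
    exact: acontM.
  have c2 : acont (fun x => (t *: one) ** (phi (q + t *: circ x) ** (zeta (dcirc x) ** lam x))).
    by apply: acontM => //; exact: acont_cst.
  have c3 : acont (fun x => F (q + t *: circ x) ** kap x).
    by apply: acontM => //; exact: acont_kap.
  move: I0; rewrite E aintB// aintM// amulZl amul1 => I0.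
  apply/esym/eqP; rewrite -subr_eq0 I0// => k x; apply: cvgB; [exact: c2|exact: c3].
have m0 : m 0 = phi q ** aint 0 T (fun x => zeta (dcirc x) ** lam x).
  rewrite -aintM//; apply: aint_eq => x; by rewrite scale0r addr0.
rewrite -m0; apply/funext => k.
apply: (@radial_linear _ (fun t => H t k) (fun t => m t k) b).
- by rewrite rho0 /= /b mulrDl !mul1r ltrDl.
- by move=> t tb; exact: Hd.
- by move=> t tb; rewrite Hm.
Qed.

(** The Cauchy formula is used at the moving centre [p0 + e *: h], where [e] enters only through the
    primitive. Differentiating the primitive releases the factor [zeta h], so what remains is a
    derivative independent of [h]. *)
Lemma directional_derivatives : exists phi' : K -> R, forall h k,
  (fun e : R => e^-1 * (phi (p0 + e *: h) k - phi p0 k)) @ at_right 0 -->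
  (zeta h ** phi') k.
Proof.
pose J := aint 0 T (fun x => phi (p0 + rho *: circ x) ** kap x).
exists (rho^-1 *: (J ** cinv)) => h k.
(* For [|e| < d] the centre stays in the half-size box where the Cauchy formula holds; the [+ 1]
   keeps the denominator positive for [h = 0]. *)
pose d := r / 2 / (`|px h| + `|py h| + `|pz h| + 1).
have d0 : 0 < d by rewrite !divr_gt0// ltr_wpDl// !addr_ge0.
have bd e : - d < e < d -> box p0 (r / 2) (p0 + e *: h).
  move=> ed; have ed' : `|e| < d by rewrite ltr_norml.
  have le (c : R) : `|c| <= `|px h| + `|py h| + `|pz h| + 1 -> `|e * c| < r / 2.
    move=> cN; rewrite normrM.
    have N0 : 0 < `|px h| + `|py h| + `|pz h| + 1 by rewrite ltr_wpDl// !addr_ge0.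
    apply: (@le_lt_trans _ _ (`|e| * (`|px h| + `|py h| + `|pz h| + 1))).
      by rewrite ler_wpM2l.
    by rewrite -ltr_pdivlMr.
  have := normr_ge0 (px h); have := normr_ge0 (py h); have := normr_ge0 (pz h) => hz hy hx.
  split; rewrite [X in `|X|]addrAC subrr add0r; apply: le.
  - change (`|px h| <= `|px h| + `|py h| + `|pz h| + 1); lra.
  - change (`|py h| <= `|px h| + `|py h| + `|pz h| + 1); lra.
  - change (`|pz h| <= `|px h| + `|py h| + `|pz h| + 1); lra.
pose N e := aint 0 T (fun x => F (p0 + rho *: circ x + e *: h) ** kap x).
have phiN e : - d < e < d -> phi (p0 + e *: h) = rho^-1 *: (N e ** cinv).
  move=> /bd/cauchy_formula.
  have -> : aint 0 T (fun x => F (p0 + e *: h + rho *: circ x) ** kap x) = N e.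
    by apply: aint_eq => x; rewrite addrAC.
  move=> ->; rewrite amulZl scalerA mulVf ?gt_eqF// scale1r.
  by rewrite -amulA cinvP amulC amul1.
have sd x : pt_deriv (fun x => p0 + rho *: circ x) x (rho *: dcirc x).
  have := pt_derivD (pt_deriv_cst p0 x) (pt_derivZ (is_derive_cst rho x 1) (pt_deriv_circ x)).
  by rewrite scale0r !add0r.
have d00 : - d < 0 < d by lra.
have Nd : aderiv N 0 (zeta h ** J).
  have wu t x : - d < t < d -> box p0 r (p0 + rho *: circ x + t *: h).
    by move=> /bd bt; rewrite addrAC; apply: rho_box => //; have := rho0; lra.
  have := aderiv_smear sd (pt_deriv_cst h) wu d00.
  congr (aderiv _ _ _); rewrite /J -aintM; last first.
    by apply: acontM; [exact: acont_phi sd|exact: acont_kap].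
  by apply: aint_eq => x; rewrite scale0r addr0 amulA.
have phid : aderiv (fun e => (rho^-1 *: cinv) ** N e) 0 (zeta h ** (rho^-1 *: (J ** cinv))).
  have := aderivM M (aderiv_cst (rho^-1 *: cinv) 0) Nd.
  rewrite amul0l add0r; congr (aderiv _ _ _).
  by rewrite amulZl amulZr amulC amulA.
apply: cvg_trans (is_derive_right (phid k)).
apply: near_eq_cvg; near=> e.
have e1' : - d < e < d.
  apply/andP; split; last by near: e; exact: nbhs_right_lt.
  by apply: (@lt_trans _ _ 0); [rewrite oppr_lt0|near: e; exact: nbhs_right_gt].
have E x : - d < x < d -> (rho^-1 *: cinv) ** N x = phi (p0 + x *: h).
  by move=> /phiN ->; rewrite amulZl amulC.
have E0 := E 0 d00; rewrite scale0r addr0 in E0.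
by rewrite (add0r e) -(E e e1') -E0.
Unshelve. all: by end_near. Qed.

Lemma circ_in_box p s : 0 < s -> exists2 rho, 0 < rho &
  forall q t x, box p (s / 2) q -> - (2 * rho) < t < 2 * rho ->
  box p s (q + t *: circ x).
Proof.
move=> s0.
pose N := `|px h1| + `|py h1| + `|pz h1| + (`|px h2| + `|py h2| + `|pz h2|) + 1.
have N0 : 0 < N by rewrite ltr_wpDl// !addr_ge0.
(* [N] bounds every coordinate of [circ x], so [|t| < 2 * rho] moves a point by at most [s / 2], the
   margin between the two boxes. *)
exists (s / 4 / N) => [|q t x [bx by' bz] tb]; first by rewrite !divr_gt0.
have tN : `|t| * N <= s / 2.
  rewrite -ler_pdivlMr//; have -> : s / 2 / N = 2 * (s / 4 / N) by field; rewrite gt_eqF.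
  by rewrite ltW// ltr_norml.
have le (c d e f : R) : `|c - d| < s / 2 -> `|e| + `|f| <= N ->
    `|c + t * (cos x * e + sin x * f) - d| < s.
  move=> cd ef; have -> : c + t * (cos x * e + sin x * f) - d =
    (c - d) + t * (cos x * e + sin x * f) by ring.
  rewrite (le_lt_trans (ler_normD _ _))// [ltRHS](_ : s = s / 2 + s / 2); last by field.
  rewrite ltr_leD// normrM; apply: le_trans tN; rewrite ler_wpM2l//.
  apply: le_trans ef; apply: le_trans (ler_normD _ _) _; rewrite !normrM lerD//.
    by rewrite ler_piMl// ler_norml cos_geN1 cos_le1.
  by rewrite ler_piMl// ler_norml sin_geN1 sin_le1.
have nn := (normr_ge0 (px h1), normr_ge0 (py h1), normr_ge0 (pz h1),
  normr_ge0 (px h2), normr_ge0 (py h2), normr_ge0 (pz h2)).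
by split; (apply: le => //; move: nn => [[[[[? ?] ?] ?] ?] ?]; rewrite /N; lra).
Qed.

End Regularity.

(** * The algebra A_n^m *)

Section ComplexAlgebra.
Variables (R : realType) (m n : nat) (Ups : 'I_n -> 'I_n -> 'I_n -> R[i]).
Hypothesis HA : is_Anm m n Ups.
Implicit Types x y z : alg R n.
Local Notation "x ** y" := (alg_mul Ups x y) (at level 40, left associativity).

Lemma alg_mulC x y : x ** y = y ** x.
Proof.
have [_ [_ [sym _]]] := HA.
apply/funext => k; rewrite /alg_mul exchange_big; apply: eq_bigr => r _.
by apply: eq_bigr => s _; rewrite sym [x s * _]mulrC.
Qed.

Lemma alg_mulA x y z : x ** (y ** z) = (x ** y) ** z.
Proof.
have [_ [_ [_ [assoc _]]]] := HA.
apply/funext => l; rewrite /alg_mul.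
(* Both sides are expanded into sums over triples of basis vectors, which associativity of the
   structure constants identifies. *)
transitivity (\sum_r \sum_s \sum_t x r * y s * z t * \sum_k Ups s t k * Ups r k l).
  apply: eq_bigr => r _.
  under eq_bigr do rewrite mulr_sumr mulr_suml.
  rewrite exchange_big; apply: eq_bigr => s _.
  under eq_bigr do rewrite mulr_sumr mulr_suml.
  rewrite exchange_big; apply: eq_bigr => t _.
  by rewrite mulr_sumr; apply: eq_bigr => k _; ring.
transitivity (\sum_k \sum_r \sum_t (\sum_s x r * y s * Ups r s k) * z t * Ups k t l).
  rewrite [RHS]exchange_big; apply: eq_bigr => r _ /=.
  transitivity (\sum_k \sum_s \sum_t x r * y s * Ups r s k * z t * Ups k t l).
    rewrite [RHS]exchange_big; apply: eq_bigr => s _; rewrite [RHS]exchange_big.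
    apply: eq_bigr => t _; rewrite -assoc mulr_sumr; apply: eq_bigr => k _; ring.
  apply: eq_bigr => k _; rewrite exchange_big; apply: eq_bigr => t _.
  by rewrite !mulr_suml.
apply: eq_bigr => k _; rewrite exchange_big; apply: eq_bigr => t _.
by rewrite !mulr_suml.
Qed.

(** The nilpotent basis vectors span an ideal and the idempotents are orthogonal, so [I_u] occurs
    only in the product of [I_u] with itself. This is what makes f_u multiplicative. *)
Lemma Ups_idem (u r s : 'I_n) : (u < m)%N -> Ups r s u = ((r == u) && (s == u))%:R.
Proof.
have [_ [mn [sym [_ [h1 [h2 h3]]]]]] := HA; move=> um.
have mixed (r' s' : 'I_n) : (r' < m)%N -> (m <= s')%N -> Ups r' s' u = 0.
  move=> rm sm; have [v _ ->//] := h3 s' sm; case: ifP => // _.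
  by rewrite (_ : u == s' = false)//; apply/negbTE/eqP => E; move: sm; rewrite -E leqNgt um.
have ne (s' : 'I_n) : (m <= s')%N -> (s' == u) = false.
  by move=> sm; apply/negbTE/eqP => E; move: sm; rewrite E leqNgt um.
have [rm|rm] := ltnP r m; have [sm|sm] := ltnP s m.
- rewrite h1//; have [->|rs] := eqVneq r s; first by rewrite andbb eq_sym.
  by have [E|//] := eqVneq r u; rewrite -E eq_sym (negbTE rs).
- by rewrite mixed// (ne s)// andbF.
- by rewrite sym mixed// (ne r).
- by rewrite h2// ?(ne r)// leq_max (ltnW (leq_trans um rm)).
Qed.

Lemma alg_mul_idem x y (u : 'I_n) : (u < m)%N -> (x ** y) u = x u * y u.
Proof.
move=> um; rewrite /alg_mul (bigD1 u)//= (bigD1 u)//= Ups_idem// !eqxx mulr1.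
rewrite big1 => [|s su]; last by rewrite Ups_idem// (negbTE su) andbF mulr0.
rewrite addr0 big1 ?addr0// => r ru; rewrite big1// => s _.
by rewrite Ups_idem// (negbTE ru) mulr0.
Qed.

Lemma alg_mul1 x : alg_one m n ** x = x.
Proof.
have [_ [mn [sym [_ [h1 [h2 h3]]]]]] := HA.
apply/funext => k; rewrite /alg_mul exchange_big (bigD1 k)//=.
(* Exactly one idempotent acts on [I_s] nontrivially: [I_s] itself if [s < m], and otherwise the one
   attached to [s]. *)
have unit_coef s : \sum_r alg_one m n r * x s * Ups r s k = x s * (k == s)%:R.
  have [sm|sm] := ltnP s m.
    rewrite (bigD1 s)//= big1 ?addr0 => [|r rs].
      by rewrite h1// eqxx /alg_one sm mul1r.
    rewrite /alg_one; have [rm|rm] := ltnP r m; last by rewrite !mul0r.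
    by rewrite h1// (negbTE rs) mulr0.
  have [u um hu] := h3 s sm; rewrite (bigD1 u)//= big1 ?addr0 => [|r ru].
    by rewrite hu// eqxx /alg_one um mul1r.
  rewrite /alg_one; have [rm|rm] := ltnP r m; last by rewrite !mul0r.
  by rewrite hu// (negbTE ru) mulr0.
rewrite unit_coef eqxx mulr1 big1 ?addr0// => s sk.
by rewrite unit_coef eq_sym (negbTE sk) mulr0.
Qed.

(* In the basis I_k, multiplication by x is triangular, its diagonal entries being
   values x u with u < m. *)
Lemma alg_inv x : (forall u : 'I_n, (u < m)%N -> x u != 0) ->
  exists y, x ** y = alg_one m n.
Proof.
have [_ [mn [sym [_ [h1 [h2 h3]]]]]] := HA; move=> x0.
pose L : 'M[R[i]]_n := \matrix_(k, r) \sum_s x s * Ups s r k.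
have Ltrig : is_trig_mx L.
  apply/is_trig_mxP => k r kr; rewrite mxE big1// => s _.
  have kr0 : (k == r) = false by apply/eqP => E; rewrite E ltnn in kr.
  have [rm|rm] := ltnP r m.
    rewrite Ups_idem; last exact: ltn_trans kr rm.
    by rewrite [r == k]eq_sym kr0 andbF mulr0.
  have [sm|sm] := ltnP s m; last by rewrite h2 ?mulr0// leq_max (ltnW kr) orbT.
  have [u _ ->//] := h3 r rm.
  by rewrite kr0; case: ifP; rewrite mulr0.
(* For [r >= m] the entry is [x u] with [u] the idempotent attached to [r]: a product of nilpotents
   involving [I_r] has only components of index above [r]. *)
have Ldiag r : L r r != 0.
  rewrite mxE; have [rm|rm] := ltnP r m.
    rewrite (bigD1 r)//= big1 ?addr0 => [|s sr].
      by rewrite Ups_idem// eqxx mulr1 x0.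
    by rewrite Ups_idem// (negbTE sr) mulr0.
  have [u um hu] := h3 r rm; rewrite (bigD1 u)//= big1 ?addr0 => [|s su].
    by rewrite hu// !eqxx mulr1 x0.
  have [sm|sm] := ltnP s m; first by rewrite hu// (negbTE su) mulr0.
  by rewrite h2 ?mulr0// leq_max leqnn orbT.
have Lunit : L \in unitmx.
  by rewrite unitmxE det_trig// unitfE; apply/prodf_neq0 => r _; exact: Ldiag.
pose b : 'cV[R[i]]_n := \col_k alg_one m n k.
exists (fun r => (invmx L *m b) r 0); apply/funext => k.
have := congr1 (fun A : 'cV_n => A k 0) (mulKVmx Lunit b).
rewrite !mxE => <-; rewrite /alg_mul exchange_big; apply: eq_bigr => r _.
by rewrite !mxE mulr_suml; apply: eq_bigr => s _; rewrite mulrAC.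
Qed.

End ComplexAlgebra.

(** * Passage from complex to real coordinates *)

Section Realification.
Variables (R : realType) (n : nat).
Implicit Types (x y : alg R n) (w z : R[i]).
Local Notation K := ('I_n * bool)%type.

Definition part (c : bool) (w : R[i]) : R := if c then cim w else cre w.

Lemma part_sum (I : Type) (s : seq I) (F : I -> R[i]) c :
  part c (\sum_(i <- s) F i) = \sum_(i <- s) part c (F i).
Proof.
apply: (big_morph (part c)); last by case: c.
by move=> [? ?] [? ?]; case: c.
Qed.

Lemma cre_mul w z : cre (w * z) = cre w * cre z - cim w * cim z.
Proof. by case: w => ? ?; case: z => ? ?. Qed.

Lemma cim_mul w z : cim (w * z) = cre w * cim z + cim w * cre z.
Proof. by case: w => ? ?; case: z => ? ?. Qed.

Lemma part_scale c (t : R) w : part c ((t%:C)%C * w) = t * part c w.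
Proof.
by rewrite /part cre_mul cim_mul /=; case: c; rewrite mul0r ?addr0 ?subr0.
Qed.

Lemma part_inj w z : (forall c, part c w = part c z) -> w = z.
Proof. by case: w => ? ?; case: z => ? ? wz; have /= -> := wz false; have /= -> := wz true. Qed.

Definition realify x : K -> R := fun k => part k.2 (x k.1).
Definition complexify (f : K -> R) : alg R n := fun j => Complex (f (j, false)) (f (j, true)).

Lemma complexifyK f : realify (complexify f) = f.
Proof. by apply/funext => -[j []]. Qed.

Lemma realify_inj x y : realify x = realify y -> x = y.
Proof.
by move=> xy; apply/funext => j; apply: part_inj => c; exact: (congr1 (@^~ (j, c)) xy).
Qed.

Definition unit_part (c : bool) : R[i] := if c then Complex 0 1 else 1.
Arguments unit_part : simpl never.

(** Structure constants for the real basis formed by the [I_j] (index [false]) and the [i I_j]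
    (index [true]). *)
Definition real_coef (Ups : 'I_n -> 'I_n -> 'I_n -> R[i]) (r s k : K) : R :=
  part k.2 (unit_part r.2 * unit_part s.2 * Ups r.1 s.1 k.1).

Lemma realifyM Ups x y :
  realify (alg_mul Ups x y) = amul (real_coef Ups) (realify x) (realify y).
Proof.
apply/funext => -[k c]; rewrite /realify /alg_mul /amul part_sum.
rewrite -(pair_bigA _ (fun r br => \sum_s part br (x r) * part s.2 (y s.1) *
   real_coef Ups (r, br) s (k, c))) /=.
apply: eq_bigr => r _; rewrite part_sum exchange_big.
rewrite -(pair_bigA _ (fun s bs => \sum_(br : bool) part br (x r) * part bs (y s) *
   real_coef Ups (r, br) (s, bs) (k, c))) /=.
apply: eq_bigr => s _; rewrite !big_bool /real_coef /=.
have reE d : cre (unit_part d) = (~~ d)%:R by case: d.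
have imE d : cim (unit_part d) = d%:R by case: d.
by case: c; rewrite /part !(cim_mul, cre_mul) !reE !imE /=; ring.
Qed.

Lemma realifyD x y : realify (alg_add x y) = realify x + realify y.
Proof.
apply/funext => -[k c]; rewrite -[RHS]/(realify x (k, c) + realify y (k, c)).
rewrite /realify /alg_add /=.
by case: c; case: (x k) => ? ?; case: (y k).
Qed.

Lemma realify_sub x y : realify (alg_sub x y) = realify x - realify y.
Proof.
apply/funext => -[k c]; rewrite -[RHS]/(realify x (k, c) - realify y (k, c)).
rewrite /realify /alg_sub /=.
by case: c; case: (x k) => ? ?; case: (y k).
Qed.

Lemma realifyZ (t : R) x : realify (alg_rscale t x) = t *: realify x.
Proof. by apply/funext => -[k c]; exact: part_scale. Qed.

Lemma realify0 : realify (alg_zero n) = 0.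
Proof. by apply/funext => -[k []]. Qed.

Variables (m : nat) (Ups : 'I_n -> 'I_n -> 'I_n -> R[i]) (a b : alg R n).
Hypothesis HA : is_Anm m n Ups.
Local Notation "x ** y" := (amul (real_coef Ups) x y) (at level 40, left associativity).
Local Notation one := (realify (alg_one m n)).

Lemma real_mulC f g : f ** g = g ** f.
Proof.
by rewrite -(complexifyK f) -(complexifyK g) -!realifyM (alg_mulC HA).
Qed.

Lemma real_mulA f g h : f ** (g ** h) = (f ** g) ** h.
Proof.
rewrite -(complexifyK f) -(complexifyK g) -(complexifyK h) -!realifyM.
by rewrite (alg_mulA HA).
Qed.

Lemma real_mul1 f : one ** f = f.
Proof. by rewrite -(complexifyK f) -!realifyM (alg_mul1 HA). Qed.

Lemma realify_zeta p :
  realify (zeta m n a b p) = zeta_real one (realify a) (realify b) p.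
Proof. by rewrite /zeta !realifyD !realifyZ. Qed.

(** [tri_integral] groups the nine terms by the differentials dx, dy, dz, the right-hand side by the
    sides of the triangle; the two differ by transposing a 3 by 3 array. *)
Lemma realify_tri_integral (Phi : alg R n -> alg R n) A B C :
  let phi q := realify (Phi (zeta m n a b q)) in
  let E := edge (real_coef Ups) one (realify a) (realify b) phi in
  realify (tri_integral m n Ups a b Phi A B C) = E A B + E B C + E C A.
Proof.
move=> phi E.
have seg_intE (coord : pt R -> R) P Q k c :
    part c (seg_int coord (fun q => Phi (zeta m n a b q) k) P Q) =
    (coord Q - coord P) * seg_mean phi P Q (k, c).
  by rewrite /seg_int mulrC part_scale; congr (_ * _); case: c.
have partD c w z : part c (w + z) = part c w + part c z.
  by case: c; case: w => ? ?; case: z.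
have triE (coord : pt R -> R) :
    realify (fun k => tri_int coord (fun q => Phi (zeta m n a b q) k) A B C) =
    (coord B - coord A) *: seg_mean phi A B + (coord C - coord B) *: seg_mean phi B C +
    (coord A - coord C) *: seg_mean phi C A.
  apply/funext => -[k c]; rewrite /realify /tri_int !partD !seg_intE.
  by [].
have edgeE P Q : E P Q = (px Q - px P) *: seg_mean phi P Q +
    (py Q - py P) *: (realify a ** seg_mean phi P Q) +
    (pz Q - pz P) *: (realify b ** seg_mean phi P Q).
  by rewrite /E /edge /zeta_real !amulDl !amulZl real_mul1.
rewrite /tri_integral 2!realifyD !realifyM !triE !edgeE !amulDr !amulZr.
have transpose (V : zmodType) (x1 x2 x3 y1 y2 y3 z1 z2 z3 : V) :
    (x1 + x2 + x3) + (y1 + y2 + y3) + (z1 + z2 + z3) =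
    (x1 + y1 + z1) + (x2 + y2 + z2) + (x3 + y3 + z3).
  rewrite (addrACA (x1 + x2) x3) (addrACA x1 x2) (addrACA _ (x3 + y3)).
  by rewrite (addrACA _ (x2 + y2)).
exact: transpose.
Qed.

End Realification.

(** * Retraction of space onto a cube *)

Section Clamp.
Variable R : realType.

Definition clamp1 (c s y : R) : R := Num.max (c - s) (Num.min y (c + s)).

Lemma continuous_clamp1 c s : continuous (clamp1 c s).
Proof.
move=> y; apply: (@continuous_max _ _ (fun=> c - s) (fun y => Num.min y (c + s))).
  exact: cvg_cst.
by apply: (@continuous_min _ _ id (fun=> c + s)); [exact: cvg_id|exact: cvg_cst].
Qed.

Lemma clamp1_near c s y : 0 < s -> `|clamp1 c s y - c| <= s.
Proof.
move=> s0; rewrite ler_distl /clamp1 le_max lexx ge_max ge_min lexx orbT andbT.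
lra.
Qed.

Lemma clamp1_id c s y : `|y - c| < s -> clamp1 c s y = y.
Proof.
rewrite ltr_distl => /andP[h1 h2].
by rewrite /clamp1 (min_idPl (ltW h2)) (max_idPr (ltW h1)).
Qed.

Definition clamp (p : pt R) s (q : pt R) : pt R :=
  (clamp1 (px p) s (px q), clamp1 (py p) s (py q), clamp1 (pz p) s (pz q)).

Lemma continuous_clamp p s : continuous (clamp p s).
Proof.
move=> q; apply: cvg_pt.
- exact: (cvg_comp (@px R) (clamp1 (px p) s) (@continuous_px _ q) (@continuous_clamp1 _ _ _)).
- exact: (cvg_comp (@py R) (clamp1 (py p) s) (@continuous_py _ q) (@continuous_clamp1 _ _ _)).
- exact: (cvg_comp (@pz R) (clamp1 (pz p) s) (@continuous_pz _ q) (@continuous_clamp1 _ _ _)).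
Qed.

(** The retraction attains the faces of the closed cube, hence the strictly larger [s']. *)
Lemma clamp_box p s s' q : 0 < s -> s < s' -> box p s' (clamp p s q).
Proof. by move=> s0 ss'; split; exact: le_lt_trans (clamp1_near _ _ s0) ss'. Qed.

Lemma clamp_id p s q : box p s q -> clamp p s q = q.
Proof.
by case: q => [[x y] z] [hx hy hz]; rewrite /clamp !clamp1_id.
Qed.

End Clamp.

(** * Invertibility of the winding integral *)

Section Winding.
Variables (R : realType) (m n : nat) (Ups : 'I_n -> 'I_n -> 'I_n -> R[i]).
Variables (a b : alg R n).
Hypothesis HA : is_Anm m n Ups.
Hypothesis surj : fu_surj m n a b.
Local Notation "x ** y" := (amul (real_coef Ups) x y) (at level 40, left associativity).
Local Notation one := (realify (alg_one m n)).
Local Notation zeta := (zeta_real one (realify a) (realify b)).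

(** The number f_u(e_2 + t e_3) must be non-real. If Im [b u] is nonzero this excludes a single [t];
    if it is zero, surjectivity of f_u forces Im [a u] to be nonzero. *)
Lemma regular_slope : exists t : R,
  forall u : 'I_n, (u < m)%N -> cim (a u) + t * cim (b u) != 0.
Proof.
(* This value exceeds the modulus of every excluded slope - Im [a u] / Im [b u]. *)
exists (1 + \sum_u `|cim (a u) / cim (b u)|) => u um; apply/eqP => E.
have [x [y [z]]] := surj um (Complex 0 1).
move=> /(congr1 cim); have cimD (v w : R[i]) : cim (v + w) = cim v + cim w.
  by case: v => ? ?; case: w.
rewrite !cimD !cim_mul /alg_one um /= !mul0r !addr0 mulr0 add0r => H.
have [b0|b0] := eqVneq (cim (b u)) 0.
  by move: E H; rewrite b0 mulr0 addr0 => ->; rewrite !mulr0 addr0 => /esym/eqP; rewrite oner_eq0.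
have : 1 + \sum_u `|cim (a u) / cim (b u)| = - (cim (a u) / cim (b u)).
  by apply: (mulIf b0); rewrite mulNr divfK//; move/eqP: E; rewrite addrC addr_eq0 => /eqP.
have : `|cim (a u) / cim (b u)| <= \sum_u `|cim (a u) / cim (b u)|.
  by rewrite (bigD1 u)//= lerDl sumr_ge0.
have := ler_norm (- (cim (a u) / cim (b u))); rewrite normrN; lra.
Qed.

Variable t : R.
Hypothesis t_regular : forall u : 'I_n, (u < m)%N -> cim (a u) + t * cim (b u) != 0.
(** [h1] and [h2] are the coordinates of e_1 and e_2 + t e_3, the axes of the ellipse. *)
Let h1 : pt R := (1, 0, 0).
Let h2 : pt R := (0, 1, t).
Local Notation circ := (circ h1 h2).
Local Notation dcirc := (dcirc h1 h2).

Lemma zeta_plane (u : 'I_n) (x y : R) : (u < m)%N ->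
  zeta (x *: h1 + y *: h2) (u, false) = x + y * (cre (a u) + t * cre (b u)) /\
  zeta (x *: h1 + y *: h2) (u, true) = y * (cim (a u) + t * cim (b u)).
Proof.
move=> um; rewrite !zeta_realE /px/py/pz/= /realify /part /alg_one um /=.
by rewrite /GRing.scale /=; split; ring.
Qed.

Lemma real_mul_idem (u : 'I_n) f g : (u < m)%N ->
  (f ** g) (u, false) = f (u, false) * g (u, false) - f (u, true) * g (u, true) /\
  (f ** g) (u, true) = f (u, false) * g (u, true) + f (u, true) * g (u, false).
Proof.
move=> um; rewrite -{1 4}(complexifyK f) -{1 4}(complexifyK g) -realifyM /realify /part /=.
by rewrite (alg_mul_idem HA)// cre_mul cim_mul.
Qed.

Lemma real_inv f : (forall u : 'I_n, (u < m)%N -> f (u, false) = 0 -> f (u, true) != 0) ->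
  exists g, f ** g = one.
Proof.
move=> f0; have [u um|y fy] := @alg_inv _ _ _ _ HA (complexify f).
  apply/eqP => E; have := congr1 cre E; have := congr1 cim E; rewrite /= => E1 E0.
  by have := f0 u um E0; rewrite E1 eqxx.
by exists (realify y); rewrite -(complexifyK f) -realifyM fy.
Qed.

(** If f_u vanished at a point of the ellipse, the imaginary part would force the sine to be zero,
    and then the real part the cosine as well. *)
Lemma circ_inv : exists lam : R -> ('I_n * bool)%type -> R,
  forall x, zeta (circ x) ** lam x = one.
Proof.
have /choice[lam lamP] : forall x, exists g, zeta (circ x) ** g = one; last by exists lam.
move=> x; apply: real_inv => u um; have [-> ->] := zeta_plane (cos x) (sin x) um.
move=> E; rewrite mulf_neq0 ?t_regular//; apply/eqP => s0.
move: E; rewrite s0 mul0r addr0 => c0; have := cos2Dsin2 x.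
by rewrite s0 c0 !expr0n addr0 => /esym/eqP; rewrite oner_eq0.
Qed.

(* With w = f_u (zeta o circ), Im (w' / w) = Im (w' conj w) / |w|^2 has constant sign, so the
   winding integral of each component is nonzero. *)
Lemma winding_inv (lam : R -> ('I_n * bool)%type -> R) :
  (forall x, zeta (circ x) ** lam x = one) ->
  exists c, aint 0 (pi *+ 2) (fun x => zeta (dcirc x) ** lam x) ** c = one.
Proof.
move=> lamP; apply: real_inv => u um _; apply/eqP => I0.
set al := cre (a u) + t * cre (b u); set be := cim (a u) + t * cim (b u).
have be0 : be != 0 by exact: t_regular.
(* [D] bounds |w|^2, because the sine and cosine are at most 1 in modulus. *)
pose D := (1 + `|al|) ^+ 2 + be ^+ 2.
have D0 : 0 < D by rewrite ltr_wpDr ?sqr_ge0// exprn_gt0// ltr_wpDr.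
have cv : acont (fun x => zeta (dcirc x) ** lam x).
  apply: acontM; first exact: acont_dcirc.
  exact: (acont_lam (real_mulC HA) (real_mulA HA) (real_mul1 HA) lamP).
(* The factor [be] fixes the sign: [be] times Im (w' / w) equals be^2 / |w|^2. *)
have low x : be ^+ 2 / D <= be * (zeta (dcirc x) ** lam x) (u, true).
  have [_ ->] := real_mul_idem (zeta (dcirc x)) (lam x) um.
  have [r1 i1] := real_mul_idem (zeta (circ x)) (lam x) um.
  have [g1 g2] := zeta_plane (cos x) (sin x) um.
  have [d1 d2] := zeta_plane (- sin x) (cos x) um.
  move: r1 i1; rewrite lamP /circ g1 g2 /dcirc d1 d2 -/al -/be.
  rewrite /realify /part /alg_one um /=.
  have := cos2Dsin2 x; have := cos_max x; have := sin_max x.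
  move: (cos x) (sin x) (lam x (u, false)) (lam x (u, true)) => c s l1 l2 hs hc cs r1 i1.
  set w1 := c + s * al in r1 i1; set w2 := s * be in r1 i1.
  (* [s2] is |w|^-2, and [E1] and [E2] say that w^-1 is the conjugate of w times [s2]. *)
  pose s2 := l1 ^+ 2 + l2 ^+ 2; have s20 : 0 <= s2 by rewrite addr_ge0 ?sqr_ge0.
  have E1 : l1 = w1 * s2.
    have -> : w1 * s2 = l1 * (w1 * l1 - w2 * l2) + l2 * (w1 * l2 + w2 * l1).
      by rewrite /s2; ring.
    by rewrite -r1 -i1 mulr1 mulr0 addr0.
  have E2 : l2 = - w2 * s2.
    have -> : - w2 * s2 = l2 * (w1 * l1 - w2 * l2) - l1 * (w1 * l2 + w2 * l1).
      by rewrite /s2; ring.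
    by rewrite -r1 -i1 mulr1 mulr0 subr0.
  move: s2 s20 E1 E2 => s2 s20 E1 E2.
  have W : (w1 ^+ 2 + w2 ^+ 2) * s2 = 1 by rewrite r1 E1 E2; ring.
  have WD : w1 ^+ 2 + w2 ^+ 2 <= D.
    apply: lerD; last first.
      by rewrite /w2 exprMn ler_piMl ?sqr_ge0// -real_normK ?num_real// expr_le1.
    rewrite -real_normK ?num_real// lerXn2r ?nnegrE ?addr_ge0//.
    apply: le_trans (ler_normD _ _) _; rewrite normrM lerD//.
    by rewrite ler_piMl.
  have -> : be * ((- s + c * al) * l2 + c * be * l1) = be ^+ 2 * s2.
    have -> : be ^+ 2 * s2 = be ^+ 2 * s2 * (c ^+ 2 + s ^+ 2) by rewrite cs mulr1.
    by rewrite E1 E2 /w1 /w2; ring.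
  rewrite ler_wpM2l ?sqr_ge0// -[leLHS]mul1r ler_pdivrMr// -W mulrC.
  by rewrite ler_wpM2l.
have c2 : continuous (fun x => be * (zeta (dcirc x) ** lam x) (u, true)).
  by move=> x; apply: cvgMr; exact: cv.
have c0 : 0 < be ^+ 2 / D by rewrite divr_gt0// exprn_even_gt0.
have := Rintegral_gt0 (pi2_gt0 R) c0 c2 low.
rewrite RintegralZl//; last exact: (continuous_integrable _ _ (cv (u, true))).
move: I0; rewrite /aint => ->.
by rewrite mulr0 ltxx.
Qed.

End Winding.

(** * Localisation to a box and conclusion *)

(** A point of the triangle is reached by two convex combinations: first on the side [B C] with
    parameter [v / (u + v)], then from [A] with parameter [u + v]. The vertex [A] itself, where
    [u + v = 0], is treated apart. *)
Lemma sub_closed_triangle_box (R : realType) (p A B C : pt R) s :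
  box p s A -> box p s B -> box p s C -> closed_triangle A B C `<=` box p s.
Proof.
have conv (x y z c u v : R) : 0 <= u -> 0 <= v -> u + v <= 1 ->
    `|x - c| < s -> `|y - c| < s -> `|z - c| < s ->
    `|x + u * (y - x) + v * (z - x) - c| < s.
  move=> u0 v0 uv hx hy hz.
  have [uv0|uv0] := eqVneq (u + v) 0.
    have -> : u = 0 by lra.
    have -> : v = 0 by lra.
    by rewrite !mul0r !addr0.
  have w01 : 0 <= v / (u + v) <= 1.
    have uvp : 0 < u + v by rewrite lt_neqAle eq_sym uv0 addr_ge0.
    by rewrite divr_ge0 ?addr_ge0// ler_pdivrMr// mul1r lerDr.
  have h := lt_norm_convex w01 hy hz.
  have uv1 : 0 <= u + v <= 1 by rewrite addr_ge0.
  have -> : x + u * (y - x) + v * (z - x) - c =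
      x + (u + v) * (y + v / (u + v) * (z - y) - x) - c by field.
  exact: lt_norm_convex.
move=> [? ? ?] [? ? ?] [? ? ?] q [u [v [u0 v0 uv ->]]].
by split; apply: conv.
Qed.

Theorem theorem3 (R : realType) (m n : nat)
  (Ups : 'I_n -> 'I_n -> 'I_n -> R[i]) (a b : alg R n)
  (Omega : set (pt R)) (Phi : alg R n -> alg R n) :
  is_Anm m n Ups ->
  lin_indep_R m n a b ->
  fu_surj m n a b ->
  is_domain Omega ->
  alg_continuous_on Omega (fun p => Phi (zeta m n a b p)) ->
  (forall A B C : pt R, nondeg_triangle A B C ->
     closed_triangle A B C `<=` Omega ->
     tri_integral m n Ups a b Phi A B C = alg_zero n) ->
  monogenic m n Ups a b Omega Phi.
Proof.
move=> HA _ surj [oO _] cPhi tri p Op.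
pose phi0 q := realify (Phi (zeta m n a b q)).
have c0 q : Omega q -> forall k, {for q, continuous (fun q => phi0 q k)}.
  by move=> Oq [j []]; have [] := cPhi q Oq j.
(* By openness and continuity, some box lies in [Omega] and carries a uniform bound on the finitely
   many coordinates of [phi0]. *)
have [s s0 sP] : exists2 s, 0 < s & box p s `<=`
    [set q | Omega q /\ forall k, `|phi0 q k| <= `|phi0 p k| + 1].
  apply: nbhs_box; near=> q; split; first by near: q; exact: open_nbhs_nbhs.
  near: q; apply: filter_forall => k.
  apply: cvgr_le (cvg_norm (c0 p Op k)) _ _.
  by rewrite ltrDl.
pose r := s / 2; have r0 : 0 < r by rewrite divr_gt0.
have rs : r < s by rewrite /r; lra.
(* Precomposing with the retraction onto a box makes phi continuous and bounded everywhere. *)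
pose phi q := phi0 (clamp p r q).
have phiE q : box p r q -> phi q = phi0 q by move=> bq; rewrite /phi clamp_id.
have cphi k : continuous (fun q => phi q k).
  move=> q; apply: (cvg_comp (clamp p r) (fun q => phi0 q k)).
    exact: continuous_clamp.
  by apply: c0; have [] := sP _ (clamp_box p q r0 rs).
have phi_bound q : anorm (phi q) <= \sum_k (`|phi0 p k| + 1).
  by apply: ler_sum => k _; have [_] := sP _ (clamp_box p q r0 rs); exact.
have tri0 A B C : box p r A -> box p r B -> box p r C -> nondeg_triangle A B C ->
    let E := edge (real_coef Ups) (realify (alg_one m n)) (realify a) (realify b) phi in
    E A B + E B C + E C A = 0.
  move=> bA bB bC nd E.
  (* Inside the box the clamped function agrees with the original along the whole segment, so the
     hypothesis on triangles carries over. *)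
  have edgeE P Q : box p r P -> box p r Q -> E P Q =
      edge (real_coef Ups) (realify (alg_one m n)) (realify a) (realify b) phi0 P Q.
    move=> bP bQ; rewrite /E /edge; congr (amul _ _ _); apply/funext => k.
    apply: eq_Rintegral => x; rewrite inE /= in_itv /= => x01.
    by rewrite phiE//; exact: box_seg.
  rewrite !edgeE// -(realify_tri_integral _ _ HA) tri ?realify0//.
  move=> q /(sub_closed_triangle_box bA bB bC) [hx hy hz].
  by have [] : _ := sP q (And3 (lt_trans hx rs) (lt_trans hy rs) (lt_trans hz rs)).
have [t treg] := regular_slope surj.
have [lam lamP] := circ_inv HA treg.
have [c cP] := winding_inv HA treg lamP.
have [rho rho0 rhoP] := circ_in_box (1, 0, 0) (0, 1, t) p r0.
have [phi' H] := directional_derivatives (real_mulC HA) (real_mulA HA) (real_mul1 HA)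
  lamP cP cphi phi_bound r0 tri0 rho0 rhoP.
(* The real derivative is read back as an element of the complex algebra; [realifyM] matches the two
   products. *)
exists (complexify phi') => h k Q L.
have LE d : part d (L k) = amul (real_coef Ups)
    (zeta_real (realify (alg_one m n)) (realify a) (realify b) h) phi' (k, d).
  by rewrite -realify_zeta -(complexifyK phi') -realifyM.
have zD (e : R) : alg_add (zeta m n a b p) (alg_rscale e (zeta m n a b h)) =
    zeta m n a b (p + e *: h).
  by apply: realify_inj; rewrite realifyD realifyZ !realify_zeta zeta_realD zeta_realZ.
have near_p : \forall e \near at_right (0 : R), box p r (p + e *: h).
  have ray (x y : R) : (fun e : R => x + e * y) @ at_right 0 --> x.
    have {2}<- : x + 0 * y = x by rewrite mul0r addr0.
    by apply: cvgD (cvg_cst _) _; apply: cvgMl; exact: cvg_within.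
  apply: box_cvg => //; [exact: (ray _ (px h))|exact: (ray _ (py h))|exact: (ray _ (pz h))].
have QE d : (fun e => part d (Q e k)) @ at_right 0 --> part d (L k).
  rewrite LE; apply: cvg_trans (H h (k, d)); apply: near_eq_cvg; near=> e.
  have be : box p r (p + e *: h).
    by near: e; exact: near_p.
  rewrite phiE// phiE; last exact: box_center.
  rewrite /Q zD part_scale; congr (_ * _).
  by rewrite -[RHS]/(realify (alg_sub _ _) (k, d)) realify_sub.
by split; [exact: (QE false)|exact: (QE true)].
Unshelve. all: by end_near. Qed.
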